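(* Let $\{|\psi_\mu\rangle\}_{\mu=1}^6=\{|+\rangle|1\rangle|0\rangle,\ |0\rangle|+\rangle|1\rangle,\ |1\rangle|0\rangle|+\rangle,\ |-\rangle|1\rangle|0\rangle,\ |0\rangle|-\rangle|1\rangle,\ |1\rangle|0\rangle|-\rangle\}$ and $\Pi_{\psi_\mu}=|\psi_\mu\rangle\langle\psi_\mu|$. Then the three-qubit quantum channel $$\mathcal{E}(\rho)=\sum_{\mu=1}^6\Pi_{\psi_\mu}\rho\,\Pi_{\psi_\mu}+\Big(\mathbb{1}-\sum_{\mu=1}^6\Pi_{\psi_\mu}\Big)\rho\Big(\mathbb{1}-\sum_{\mu=1}^6\Pi_{\psi_\mu}\Big)$$ is a completely stabilizer-preserving operation (CSPO) that is not a stabilizer operation.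
   Context: Here $|0\rangle,|1\rangle$ is the computational basis of $\mathbb{C}^2$, $|\pm\rangle=\frac{1}{\sqrt2}(|0\rangle\pm|1\rangle)$, and juxtaposition denotes tensor product. Pauli and Clifford groups: $X,Y,Z$ are the single-qubit Pauli matrices; $\mathcal{P}_n=\langle X,Y,Z\rangle^{\otimes n}$ is the $n$-qubit Pauli group; the Clifford group is $\mathrm{Cl}_n=\{V\in U(2^n): V\mathcal{P}_nV^\dagger=\mathcal{P}_n\}$. A pure $n$-qubit stabilizer state is a state of the form $U|0\rangle^{\otimes n}$ (up to phase) with $U\in\mathrm{Cl}_n$; a (mixed) stabilizer state is a convex combination of pure stabilizer states. CSPO: a quantum channel $\mathcal{E}$ is completely stabilizer-preserving if for every $k\ge 0$ the channel $\mathcal{E}\otimes\mathrm{id}_k$ (with $\mathrm{id}_k$ the identity channel on $k$ further qubits) maps every (mixed) stabilizer state to a (mixed) stabilizer state. Stabilizer operation: a quantum channel is a stabilizer operation if it can be realized by a finite, arbitrarily long sequence of steps, each of one of the following kinds: (1) appending ancillary qubits in computational basis states; (2) applying a Clifford unitary to the qubits currently present; (3) performing a projective measurement of a qubit in the computational basis. The choice of each step may depend adaptively on all previous measurement outcomes. Qubits may be discarded (partial trace) and the measurement record may be averaged over at the end. *)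

(* Defs.v *)
From mathcomp Require Import all_boot all_order all_algebra.
From mathcomp Require Import classical_sets reals complex mxtens.

Set Implicit Arguments.
Unset Strict Implicit.
Unset Printing Implicit Defensive.

Import Order.TTheory GRing.Theory Num.Theory.
Local Open Scope complex_scope.
Local Open Scope ring_scope.
Local Open Scope sesquilinear_scope.

(* Linear maps from n qubits to m qubits.  Kets are the case n = 0, bras the
   case m = 0 ('M_(2 ^ n, 2 ^ 0) is convertible to 'cV_(2 ^ n)).  Qubit 0 is
   the leftmost tensor factor, i.e. the most significant bit of an index. *)
Notation qmat R m n := 'M[complex R]_(2 ^ m, 2 ^ n).

Definition tensor {R : realType} {m n p q : nat}
    (A : qmat R m n) (B : qmat R p q) : qmat R (m + p) (n + q) :=
  castmx (esym (expnD 2 m p), esym (expnD 2 n q)) (tensmx A B).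

Notation "A ⊗ B" := (tensor A B)
  (at level 40, left associativity) : ring_scope.

Section States.
Context {R : realType}.

Definition ket (b : bool) : qmat R 1 0 := \col_(i < 2) (i == b :> nat)%:R.

(* [ket_plus false] is |+>, [ket_plus true] is |->. *)
Definition ket_plus (b : bool) : qmat R 1 0 :=
  (sqrtC 2)^-1 *: (ket false + (-1) ^+ b *: ket true).

Fixpoint ket0s (n : nat) : qmat R n 0 :=
  if n is n'.+1 then ket false ⊗ ket0s n' else 1%:M.

Definition proj n (psi : qmat R n 0) : qmat R n n := psi *m psi ^t*.

Definition pauliX : qmat R 1 1 :=
  ket false *m ket true ^t* + ket true *m ket false ^t*.
Definition pauliY : qmat R 1 1 :=
  - 'i%C *: (ket false *m ket true ^t*) + 'i%C *: (ket true *m ket false ^t*).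
Definition pauliZ : qmat R 1 1 :=
  ket false *m ket false ^t* - ket true *m ket true ^t*.

(* The group generated by X, Y, Z (it contains the phases 1, i, -1, -i). *)
Inductive pauli1 : qmat R 1 1 -> Prop :=
| pauli1_X : pauli1 pauliX
| pauli1_Y : pauli1 pauliY
| pauli1_Z : pauli1 pauliZ
| pauli1_1 : pauli1 1%:M
| pauli1_M A B : pauli1 A -> pauli1 B -> pauli1 (A *m B)
| pauli1_V A : pauli1 A -> pauli1 (invmx A).

Fixpoint pauli (n : nat) : set (qmat R n n) :=
  if n is n'.+1 then
    [set P | exists A B, [/\ pauli1 A, pauli B & P = A ⊗ B]]%classic
  else [set 1%:M]%classic.

Definition clifford n (V : qmat R n n) : Prop :=
  V \is unitarymx /\
  ((fun P : qmat R n n => V *m P *m V ^t*) @` @pauli n = @pauli n)%classic.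

Definition pure_stabilizer n (psi : qmat R n 0) : Prop :=
  exists (U : qmat R n n) (c : R[i]),
    [/\ clifford U, `|c| = 1 & psi = c *: (U *m ket0s n)].

Definition stabilizer_state n (rho : qmat R n n) : Prop :=
  exists (N : nat) (p : 'I_N -> R) (psi : 'I_N -> qmat R n 0),
    [/\ forall j, 0 <= p j, \sum_j p j = 1,
        forall j, pure_stabilizer (psi j) &
        rho = \sum_j (p j)%:C *: proj (psi j)].

End States.

Section Channels.
Context {R : realType}.

(* Over R[i] the order [0 <= z] says that z is real and nonnegative. *)
Definition psd n (A : qmat R n n) : Prop :=
  forall v : qmat R n 0, 0 <= \tr (v ^t* *m A *m v).

(* The (a, b) block (1 ⊗ <a|) rho (1 ⊗ |b>) of an operator on n + k qubits. *)
Definition block n k (rho : qmat R (n + k) (n + k)) (a b : 'I_(2 ^ k)) :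
    qmat R n n :=
  \matrix_(i, j) (castmx (expnD 2 n k, expnD 2 n k) rho)
                   (mxtens_index (i, a)) (mxtens_index (j, b)).

(* E ⊗ id_k, from rho = \sum_(a, b) (block rho a b) ⊗ |a><b|. *)
Definition ampliation n m (E : qmat R n n -> qmat R m m) (k : nat)
    (rho : qmat R (n + k) (n + k)) : qmat R (m + k) (m + k) :=
  \sum_(a < 2 ^ k) \sum_(b < 2 ^ k)
    E (block rho a b) ⊗ (delta_mx a b : qmat R k k).

Definition quantum_channel n m (E : qmat R n n -> qmat R m m) : Prop :=
  [/\ linear E,
      forall k (rho : qmat R (n + k) (n + k)),
        psd rho -> psd (ampliation E rho) &
      forall rho, \tr (E rho) = \tr rho].

Definition CSPO n m (E : qmat R n n -> qmat R m m) : Prop :=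
  quantum_channel E /\
  forall k (rho : qmat R (n + k) (n + k)),
    stabilizer_state rho -> stabilizer_state (ampliation E rho).

(* The isometry inserting a fresh qubit in state |b> at position i <= n. *)
Fixpoint insert_ket (b : bool) (n i : nat) : qmat R n.+1 n :=
  match n, i with
  | n'.+1, i'.+1 => (1%:M : qmat R 1 1) ⊗ insert_ket b n' i'
  | n', _ => ket b ⊗ (1%:M : qmat R n' n')
  end.

(* |b><b| on qubit i, identity on the other qubits. *)
Definition meas_proj (b : bool) n (i : 'I_n.+1) : qmat R n.+1 n.+1 :=
  insert_ket b n i *m (insert_ket b n i) ^t*.

(* Adaptive protocols from n qubits to m qubits, as finite decision trees.
   Positions are arbitrary, and branches may use different numbers of steps
   and of ancillas; the number m of output qubits is common to all leaves. *)
Inductive protocol (m : nat) : nat -> Type :=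
| Stop : protocol m m
| Append n (i : 'I_n.+1) (b : bool) of protocol m n.+1 : protocol m n
| Apply n (U : qmat R n n) of clifford U & protocol m n : protocol m n
| Measure n (i : 'I_n.+1) of (bool -> protocol m n.+1) : protocol m n.+1
| Discard n (i : 'I_n.+1) of protocol m n : protocol m n.+1.

(* Branches carry unnormalised states, whose trace is the probability of the
   branch; summing them averages over the measurement record. *)
Fixpoint run m n (p : protocol m n) : qmat R n n -> qmat R m m :=
  match p in protocol _ n return qmat R n n -> qmat R m m with
  | Stop => fun rho => rho
  | @Append _ n i b p' => fun rho =>
      run p' (insert_ket b n i *m rho *m (insert_ket b n i) ^t*)
  | Apply _ U _ p' => fun rho => run p' (U *m rho *m U ^t*)
  | Measure _ i p' => fun rho =>
      \sum_(b : bool) run (p' b) (meas_proj b i *m rho *m meas_proj b i)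
  | @Discard _ n i p' => fun rho =>
      run p' (\sum_(b : bool)
                (insert_ket b n i) ^t* *m rho *m insert_ket b n i)
  end.

Definition stabilizer_operation n m (E : qmat R n n -> qmat R m m) : Prop :=
  quantum_channel E /\ exists p : protocol m n, forall rho, E rho = run p rho.

End Channels.

Section Example.
Context {R : realType}.

Definition psi (mu : 'I_6) : qmat R 3 0 :=
  tnth [tuple of
    [:: ket_plus false ⊗ ket true       ⊗ ket false;
        ket false      ⊗ ket_plus false ⊗ ket true;
        ket true       ⊗ ket false      ⊗ ket_plus false;
        ket_plus true  ⊗ ket true       ⊗ ket false;
        ket false      ⊗ ket_plus true  ⊗ ket true;
        ket true       ⊗ ket false      ⊗ ket_plus true] : seq (qmat R 3 0)] mu.

Definition psi_channel (rho : qmat R 3 3) : qmat R 3 3 :=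
  let Q := 1%:M - \sum_(mu < 6) proj (psi mu) in
  \sum_(mu < 6) proj (psi mu) *m rho *m proj (psi mu) + Q *m rho *m Q.

End Example.

(* Main.v *)
(* The Kraus operators of E are the six projectors onto the psi_mu and the
   projector Q onto span(|000>, |111>). Each is a product of projectors (1 + P)/2
   with P a Hermitian Pauli, and such a projector maps a pure stabilizer state to
   a multiple of a pure stabilizer state, with or without spectator qubits.

   Conversely, let a protocol realize E. Since E fixes the line of each of the
   psi_mu, |000> and |111>, every Kraus operator L of the protocol is diagonal in
   this orthonormal basis, and so is M^* M = sum L^* L for the Kraus operator M
   accumulated on the way to any node. At the first measurement whose outcome
   depends on the input, M^* M is a multiple of 1 + P with P a nontrivial Pauli
   of the input; but no nontrivial Pauli is diagonal in the basis. Hence no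
   measurement reveals anything, each L is a multiple of a Clifford unitary
   diagonal in the basis, and such an operator fixes the line of |100>. But E
   maps |100><100| to an equal mixture of |100><100| and |101><101|. *)

From mathcomp Require Import all_boot all_order all_algebra.
From mathcomp Require Import boolp classical_sets reals complex mxtens zify ring.
Require Import Defs.

Set Implicit Arguments.
Unset Strict Implicit.
Unset Printing Implicit Defensive.

Import Order.TTheory GRing.Theory Num.Theory.
Local Open Scope complex_scope.
Local Open Scope ring_scope.
Local Open Scope sesquilinear_scope.

(** * Matrices, inner products and tensor products *)

Section Adjoint.
Context {C : numClosedFieldType}.

Lemma adjmxM m n p (A : 'M[C]_(m, n)) (B : 'M[C]_(n, p)) :
  (A *m B) ^t* = B ^t* *m A ^t*.
Proof. by rewrite trmx_mul map_mxM. Qed.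

Lemma adjmxK m n (A : 'M[C]_(m, n)) : A ^t* ^t* = A.
Proof. by apply/matrixP=> i j; rewrite !mxE conjCK. Qed.

Lemma adjmxD m n (A B : 'M[C]_(m, n)) : (A + B) ^t* = A ^t* + B ^t*.
Proof. by apply/matrixP=> i j; rewrite !mxE rmorphD. Qed.

Lemma adjmxB m n (A B : 'M[C]_(m, n)) : (A - B) ^t* = A ^t* - B ^t*.
Proof. by apply/matrixP=> i j; rewrite !mxE rmorphB. Qed.

Lemma adjmxZ m n (a : C) (A : 'M[C]_(m, n)) : (a *: A) ^t* = a ^* *: A ^t*.
Proof. by apply/matrixP=> i j; rewrite !mxE rmorphM. Qed.

Lemma adjmx1 n : (1%:M : 'M[C]_n) ^t* = 1%:M.
Proof. by rewrite trmx1 map_mx1. Qed.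

Lemma adjmx0 m n : (0 : 'M[C]_(m, n)) ^t* = 0.
Proof. by rewrite trmx0 map_mx0. Qed.

Lemma adjmx_sum m n (I : Type) (r : seq I) (F : I -> 'M[C]_(m, n)) :
  (\sum_(i <- r) F i) ^t* = \sum_(i <- r) (F i) ^t*.
Proof.
by elim/big_rec2: _ => [|i A B _ <-]; rewrite ?adjmx0 ?adjmxD.
Qed.

(** Conjugate-linear in the first argument; the trace of a 1 by 1 matrix has the shape used in
    [psd]. *)
Definition dot n (u v : 'cV[C]_n) : C := \tr (u ^t* *m v).

Lemma dotE n (u v : 'cV[C]_n) : u ^t* *m v = (dot u v)%:M.
Proof. by rewrite [LHS]mx11_scalar /dot /mxtrace big_ord1. Qed.

Lemma dot_sum_sqr n (u : 'cV[C]_n) : dot u u = \sum_i `|u i 0| ^+ 2.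
Proof.
rewrite /dot /mxtrace big_ord1 mxE; apply: eq_bigr => i _.
by rewrite !mxE normCK mulrC.
Qed.

Lemma dot_eq0 n (u : 'cV[C]_n) : (dot u u == 0) = (u == 0).
Proof.
apply/eqP/eqP=> [|->]; last by rewrite /dot mulmx0 mxtrace0.
rewrite dot_sum_sqr => /psumr_eq0P h; apply/matrixP=> i j.
rewrite ord1 mxE; apply/eqP; rewrite -normr_eq0 -sqrf_eq0; apply/eqP/h => //.
by move=> k _; rewrite exprn_ge0.
Qed.

Lemma dotC n (u v : 'cV[C]_n) : dot u v = (dot v u) ^*.
Proof.
rewrite /dot /mxtrace !big_ord1 !mxE rmorph_sum.
by apply: eq_bigr => i _; rewrite !mxE rmorphM /= conjCK mulrC.
Qed.

Lemma dot0r n (u : 'cV[C]_n) : dot u 0 = 0.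
Proof. by rewrite /dot mulmx0 mxtrace0. Qed.

Lemma dotDr n (u v w : 'cV[C]_n) : dot u (v + w) = dot u v + dot u w.
Proof. by rewrite /dot mulmxDr mxtraceD. Qed.

Lemma dotDl n (u v w : 'cV[C]_n) : dot (v + w) u = dot v u + dot w u.
Proof. by rewrite /dot adjmxD mulmxDl mxtraceD. Qed.

Lemma dotZr n a (u v : 'cV[C]_n) : dot u (a *: v) = a * dot u v.
Proof. by rewrite /dot -scalemxAr mxtraceZ. Qed.

Lemma dotZl n a (u v : 'cV[C]_n) : dot (a *: u) v = a ^* * dot u v.
Proof. by rewrite /dot adjmxZ -scalemxAl mxtraceZ. Qed.

Lemma dot_mul m n (A : 'M[C]_(m, n)) u v : dot u (A *m v) = dot (A ^t* *m u) v.
Proof. by rewrite /dot adjmxM adjmxK mulmxA. Qed.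

End Adjoint.

Section Tensor.
Context {R : realType}.

Lemma tensor_mul m n p q r s (A : qmat R m n) (B : qmat R p q)
    (C : qmat R n r) (D : qmat R q s) :
  (A ⊗ B) *m (C ⊗ D) = (A *m C) ⊗ (B *m D).
Proof.
rewrite /tensor -tensmx_mul.
case: _ / (esym (expnD 2 m p)); case: _ / (esym (expnD 2 n q)).
by case: _ / (esym (expnD 2 r s)).
Qed.

Lemma adjmx_tensor m n p q (A : qmat R m n) (B : qmat R p q) :
  (A ⊗ B) ^t* = A ^t* ⊗ B ^t*.
Proof.
by rewrite /tensor trmx_cast map_castmx /= trmx_tens map_mxT.
Qed.

Lemma tensorDl m n p q (A A' : qmat R m n) (B : qmat R p q) :
  (A + A') ⊗ B = A ⊗ B + A' ⊗ B.
Proof. by apply/matrixP=> i j; rewrite !(castmxE, mxE) mulrDl. Qed.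

Lemma tensorDr m n p q (A : qmat R m n) (B B' : qmat R p q) :
  A ⊗ (B + B') = A ⊗ B + A ⊗ B'.
Proof. by apply/matrixP=> i j; rewrite !(castmxE, mxE) mulrDr. Qed.

Lemma tensorZl m n p q a (A : qmat R m n) (B : qmat R p q) :
  (a *: A) ⊗ B = a *: (A ⊗ B).
Proof. by apply/matrixP=> i j; rewrite !(castmxE, mxE) mulrA. Qed.

Lemma tensorZr m n p q a (A : qmat R m n) (B : qmat R p q) :
  A ⊗ (a *: B) = a *: (A ⊗ B).
Proof. by apply/matrixP=> i j; rewrite !(castmxE, mxE) mulrCA. Qed.

Lemma tensor0l m n p q (B : qmat R p q) : (0 : qmat R m n) ⊗ B = 0.
Proof. by rewrite -(scale0r (0 : qmat R m n)) tensorZl scale0r. Qed.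

Lemma tensor0r m n p q (A : qmat R m n) : A ⊗ (0 : qmat R p q) = 0.
Proof. by rewrite -(scale0r (0 : qmat R p q)) tensorZr scale0r. Qed.

Lemma tensorNl m n p q (A : qmat R m n) (B : qmat R p q) :
  (- A) ⊗ B = - (A ⊗ B).
Proof. by rewrite -scaleN1r tensorZl scaleN1r. Qed.

Lemma tensorNr m n p q (A : qmat R m n) (B : qmat R p q) :
  A ⊗ (- B) = - (A ⊗ B).
Proof. by rewrite -[- B]scaleN1r tensorZr scaleN1r. Qed.

Lemma tensor_suml m n p q I (s : seq I) (F : I -> qmat R m n) (B : qmat R p q) :
  (\sum_(i <- s) F i) ⊗ B = \sum_(i <- s) F i ⊗ B.
Proof.
by elim/big_rec2: _ => [|i A A' _ <-]; rewrite ?tensor0l ?tensorDl.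
Qed.

Lemma tensor1 m n : (1%:M : qmat R m m) ⊗ (1%:M : qmat R n n) = 1%:M.
Proof.
apply/matrixP=> i j; rewrite !(castmxE, mxE) /= -natrM mulnb !esymK.
rewrite -[RHS](_ : ((cast_ord (expnD 2 m n) i == cast_ord (expnD 2 m n) j))%:R = _).
  congr (_%:R); rewrite -[in RHS](mxtens_unindexK (cast_ord _ i)).
  rewrite -[in RHS](mxtens_unindexK (cast_ord _ j)) (can_eq (@mxtens_indexK _ _)).
  by rewrite /= xpair_eqE.
by rewrite (inj_eq (@cast_ord_inj _ _ _)).
Qed.

(** The two sizes are equal but in general not convertible, so one side is cast along arbitrary
    proofs. The claim is then the arithmetic of quotients and remainders of indices. *)
Lemma tensorA m n p q r s e1 e2 (A : qmat R m n) (B : qmat R p q)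
    (C : qmat R r s) :
  castmx (e1, e2) ((A ⊗ B) ⊗ C) = A ⊗ (B ⊗ C).
Proof.
apply/matrixP=> i j; rewrite !(castmxE, mxE) /= mulrA.
congr (A _ _ * B _ _ * C _ _); apply: val_inj => /=.
all: rewrite ?(expnD 2 p r, expnD 2 q s).
1,2: by rewrite mulnC divnMA.
1,2: by rewrite modn_divl.
all: by rewrite modn_dvdm ?dvdn_mull.
Qed.

Lemma tensor1l m n (A : qmat R m n) : (1%:M : qmat R 0 0) ⊗ A = A.
Proof.
apply/matrixP=> i j; rewrite !(castmxE, mxE) /= !ord1 /= mul1r.
by congr (A _ _); apply: val_inj; rewrite /= modn_small.
Qed.

Lemma dot_tensor m n (a c : qmat R m 0) (b d : qmat R n 0) :
  dot (a ⊗ b : qmat R (m + n) 0) (c ⊗ d : qmat R (m + n) 0) = dot a c * dot b d.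
Proof.
have := tensor_mul (a ^t*) (b ^t*) c d; rewrite -adjmx_tensor => h.
rewrite /dot h /mxtrace !big_ord1 !(castmxE, mxE) /=.
by rewrite !ord1.
Qed.
End Tensor.

(** * Pauli and Clifford groups *)

Section Pauli.
Context {R : realType}.
Implicit Types (a b c d x y : bool).

Notation ket := (@ket R).

Lemma ket_bra b c : (ket b) ^t* *m ket c = (b == c)%:R%:M.
Proof.
apply/matrixP=> i j; rewrite !mxE big_ord_recl big_ord1 !mxE !ord1 /=.
by case: b; case: c; rewrite ?conjC0 ?conjC1 /= ?(mul1r, mul0r, mulr0, addr0, add0r).
Qed.

Lemma dot_ket b c : dot (ket b) (ket c) = (b == c)%:R.
Proof. by rewrite /dot ket_bra mxtrace_scalar. Qed.

Lemma ket_complete : \sum_b ket b *m (ket b) ^t* = 1%:M.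
Proof.
rewrite big_bool; apply/matrixP=> i j; rewrite !mxE !big_ord1 !mxE.
case: i j => [[|[|[]]] // ?] [[|[|[]]] // ?] /=;
  by rewrite ?conjC0 ?conjC1 ?(mul1r, mul0r, mulr0, addr0, add0r).
Qed.

Lemma ket_ext m (A B : qmat R m 1) :
  (forall b, A *m ket b = B *m ket b) -> A = B.
Proof.
move=> h; rewrite -[A]mulmx1 -[B]mulmx1 -ket_complete !mulmx_sumr.
by apply: eq_bigr => b _; rewrite !mulmxA h.
Qed.

(* X^a Z^b, up to phase the general single-qubit Pauli matrix. *)
Definition xz a b : qmat R 1 1 :=
  \sum_c (-1) ^+ (b && c) *: (ket (a (+) c) *m (ket c) ^t*).

Lemma xz_ket a b c : xz a b *m ket c = (-1) ^+ (b && c) *: ket (a (+) c).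
Proof.
rewrite mulmx_suml (bigD1 c) //= big1 => [|d /negPf dc].
  by rewrite addr0 -scalemxAl -mulmxA ket_bra eqxx mulmx1.
by rewrite -scalemxAl -mulmxA ket_bra dc mul_mx_scalar scale0r scaler0.
Qed.

Lemma xzM a b c d :
  xz a b *m xz c d = (-1) ^+ (b && c) *: xz (a (+) c) (b (+) d).
Proof.
apply: ket_ext => x; rewrite -mulmxA -scalemxAl !xz_ket -scalemxAr xz_ket !scalerA.
rewrite addbA -!signr_addb; congr ((-1) ^+ nat_of_bool _ *: _).
by case: b; case: c; case: d; case: x.
Qed.

Lemma xz00 : xz false false = 1%:M.
Proof. by apply: ket_ext => c; rewrite xz_ket mul1mx scale1r. Qed.

Lemma xz_adj a b : (xz a b) ^t* = (-1) ^+ (a && b) *: xz a b.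
Proof.
apply: ket_ext => x; rewrite -scalemxAl xz_ket adjmx_sum mulmx_suml.
rewrite (bigD1 (a (+) x)) //= big1 => [|d dc].
  rewrite adjmxZ adjmxM adjmxK rmorph_sign -scalemxAl -mulmxA ket_bra addbA addbb.
  rewrite addFb eqxx mulmx1 addr0 scalerA -signr_addb.
  by congr ((-1) ^+ nat_of_bool _ *: _); case: a; case: b; case: x.
rewrite adjmxZ adjmxM adjmxK -scalemxAl -mulmxA ket_bra.
rewrite (_ : _ == _ = false) ?mul_mx_scalar ?scale0r ?scaler0 //.
by move: dc; case: a; case: x; case: d.
Qed.

Lemma pauliX_xz : pauliX = xz true false.
Proof.
apply: ket_ext => b; rewrite xz_ket mulmxDl -!mulmxA !ket_bra !mul_mx_scalar.
by case: b; rewrite /= !(scale0r, scale1r, addr0, add0r, expr0).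
Qed.

Lemma pauliZ_xz : pauliZ = xz false true.
Proof.
apply: ket_ext => b; rewrite xz_ket mulmxBl -!mulmxA !ket_bra !mul_mx_scalar.
by case: b; rewrite /= !(scale0r, scale1r, subr0, sub0r, expr0, expr1, scaleN1r).
Qed.

Lemma pauliY_xz : pauliY = 'i%C *: xz true true.
Proof.
apply: ket_ext => b; rewrite -!scalemxAl xz_ket mulmxDl -!scalemxAl -!mulmxA.
rewrite !ket_bra !mul_mx_scalar.
by case: b; rewrite /= !(scale0r, scale1r, scaler0, addr0, add0r, expr0, expr1,
  scaleN1r, scaleNr, scalerN, oppr0).
Qed.

Lemma norm_i : `|'i%C : R[i]| = 1.
Proof. by apply/eqP; rewrite -sqrp_eq1 ?normr_ge0 // -normrX sqr_i normrN1. Qed.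

Lemma signr_i b : (-1) ^+ b = 'i%C ^+ (b.*2) :> R[i].
Proof. by rewrite -mul2n exprM sqr_i. Qed.

(** The matrices i^k X^a Z^b are closed under products and inverses by [xzM]. Conversely Y Z X = i,
    so every phase i^k lies in the group. *)
Lemma pauli1P (A : qmat R 1 1) :
  pauli1 A <-> exists k a b, A = 'i%C ^+ k *: xz a b.
Proof.
split.
  elim=> {A} [||||A B _ [k [a [b ->]]] _ [l [c [d ->]]]|A _ [k [a [b ->]]]].
  - by exists 0, true, false; rewrite scale1r pauliX_xz.
  - by exists 1, true, true; rewrite pauliY_xz.
  - by exists 0, false, true; rewrite scale1r pauliZ_xz.
  - by exists 0, false, false; rewrite scale1r xz00.
  - exists (k + l + (b && c).*2)%N, (a (+) c), (b (+) d).
    by rewrite -scalemxAl -scalemxAr xzM !scalerA signr_i -!exprD.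
  (* Here i^(3k) inverts i^k, and the sign i^(2ab) cancels that of the square of [xz a b]. *)
  exists (3 * k + (a && b).*2)%N, a, b.
  set B := RHS; have AB : ('i%C ^+ k *: xz a b) *m B = 1%:M.
    rewrite /B -scalemxAl -scalemxAr xzM !scalerA !addbb xz00 signr_i -!exprD.
    rewrite andbC -addnA -!mul2n (_ : (_ + _)%N = 4 * (k + (a && b)))%N; last first.
      by rewrite [b && a]andbC; lia.
    by rewrite exprM (exprM _ 2 2) sqr_i sqrrN !expr1n scale1r.
  have [uA _] := mulmx1_unit AB.
  by rewrite -[LHS]mulmx1 -AB mulmxA mulVmx // mul1mx.
case=> k [a [b ->]].
have pi : pauli1 ('i%C *: 1%:M : qmat R 1 1).
  have -> : 'i%C *: 1%:M = pauliY *m pauliZ *m pauliX *m (pauliX *m pauliX) :> qmat R 1 1.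
    rewrite pauliX_xz pauliY_xz pauliZ_xz -!scalemxAl.
    by do ![rewrite xzM /= ?expr0 scale1r]; rewrite xz00.
  by do !apply: pauli1_M; constructor.
have pik : pauli1 ('i%C ^+ k *: 1%:M : qmat R 1 1).
  elim: k => [|k ih]; first by rewrite scale1r; constructor.
  rewrite exprS -scalerA -[_ *: 1%:M]mul1mx scalemxAl.
  exact: pauli1_M.
rewrite -[xz a b]mul1mx scalemxAl; apply: pauli1_M => //.
have -> : xz a b = xz a false *m xz false b by rewrite xzM /= scale1r addbF.
apply: pauli1_M.
  by case: a; rewrite -?pauliX_xz ?xz00; constructor.
by case: b; rewrite -?pauliZ_xz ?xz00; constructor.
Qed.

End Pauli.

(** * The n-qubit Pauli group and its action on |0...0> *)

Section PauliGroup.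
Context {R : realType}.

Lemma pauli1_unitary (A : qmat R 1 1) : pauli1 A -> A ^t* *m A = 1%:M.
Proof.
move=> /pauli1P [k [a [b ->]]]; rewrite adjmxZ -scalemxAl -scalemxAr scalerA.
rewrite mulrC -normCK normrX norm_i !expr1n scale1r xz_adj -scalemxAl xzM.
by rewrite scalerA andbC -signr_addb !addbb expr0 scale1r xz00.
Qed.

Lemma pauli1N (A : qmat R 1 1) : pauli1 A -> pauli1 (- A).
Proof.
move=> /pauli1P [k [a [b ->]]]; apply/pauli1P; exists (2 + k)%N, a, b.
by rewrite exprD sqr_i -scalerA scaleN1r.
Qed.

Lemma pauli1_comm (A B : qmat R 1 1) : pauli1 A -> pauli1 B ->
  exists s : bool, B *m A = (-1) ^+ s *: (A *m B).
Proof.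
move=> /pauli1P [k [a [b ->]]] /pauli1P [l [c [d ->]]].
exists ((a && d) (+) (b && c)).
rewrite -!scalemxAl -!scalemxAr !xzM !scalerA signr_addb [c (+) a]addbC [d (+) b]addbC.
congr (_ *: _); rewrite [d && a]andbC.
by case: (a && d); case: (b && c); rewrite ?expr0 ?expr1; ring.
Qed.

Lemma pauli1_ket (A : qmat R 1 1) : pauli1 A ->
  (exists f : bool -> R[i], forall b, A *m ket b = f b *: ket b) \/
  (exists f : bool -> R[i], forall b, A *m ket b = f b *: ket (~~ b)).
Proof.
move=> /pauli1P [k [[] [b ->]]]; [right|left]; exists (fun c => 'i%C ^+ k * (-1) ^+ (b && c));
  by move=> c; rewrite -scalemxAl xz_ket scalerA.
Qed.

(* The general tensor lemmas at the types [n.+1] occurring in [pauli] and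
   [ket0s]: rewriting does not identify [n.+1] with [1 + n] by itself. *)
Lemma mul_tensorS n (A A' : qmat R 1 1) (B B' : qmat R n n) :
  (A ⊗ B : qmat R n.+1 n.+1) *m (A' ⊗ B' : qmat R n.+1 n.+1) =
  (A *m A') ⊗ (B *m B').
Proof. exact: tensor_mul A B A' B'. Qed.

Lemma mul_tensorS_ket n (A : qmat R 1 1) (B : qmat R n n) (u : qmat R 1 0)
    (v : qmat R n 0) :
  (A ⊗ B : qmat R n.+1 n.+1) *m (u ⊗ v : qmat R n.+1 0) = (A *m u) ⊗ (B *m v).
Proof. exact: tensor_mul A B u v. Qed.

Lemma ket0sS n : ket0s n.+1 = ket false ⊗ ket0s n :> qmat R n.+1 0.
Proof. by []. Qed.

Lemma adj_tensorS n (A : qmat R 1 1) (B : qmat R n n) :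
  (A ⊗ B : qmat R n.+1 n.+1) ^t* = A ^t* ⊗ B ^t*.
Proof. exact: adjmx_tensor A B. Qed.

Lemma tensorS1 n :
  (1%:M : qmat R 1 1) ⊗ (1%:M : qmat R n n) = 1%:M :> qmat R n.+1 n.+1.
Proof. exact: tensor1 1 n. Qed.

Lemma pauli_cons n (A : qmat R 1 1) (B : qmat R n n) :
  pauli1 A -> pauli B -> @pauli R n.+1 (A ⊗ B).
Proof. by exists A, B. Qed.

Lemma pauliSP n (P : qmat R n.+1 n.+1) : pauli P ->
  exists A B, [/\ pauli1 A, pauli B & P = A ⊗ B :> qmat R n.+1 n.+1].
Proof. by []. Qed.

Lemma pauli_one n : pauli (1%:M : qmat R n n).
Proof.
by elim: n => [//|n ih]; rewrite -tensorS1; apply: pauli_cons => //; constructor.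
Qed.

Lemma pauliM n (P Q : qmat R n n) : pauli P -> pauli Q -> pauli (P *m Q).
Proof.
elim: n P Q => [|n ih] P Q; first by move=> -> ->; rewrite mulmx1.
move=> /pauliSP [A [B [hA hB ->]]] /pauliSP [A' [B' [hA' hB' ->]]].
by rewrite mul_tensorS; apply: pauli_cons; [exact: pauli1_M|exact: ih].
Qed.

Lemma pauli_unitary n (P : qmat R n n) : pauli P -> P ^t* *m P = 1%:M.
Proof.
elim: n P => [|n ih] P; first by move=> ->; rewrite adjmx1 mulmx1.
move=> /pauliSP [A [B [hA hB ->]]]; rewrite adj_tensorS mul_tensorS.
by rewrite pauli1_unitary // ih // tensorS1.
Qed.

(** On zero qubits the group is {1} and contains no sign, hence the successor here and in the lemmas
    built on it. *)
Lemma pauliN n (P : qmat R n.+1 n.+1) : pauli P -> pauli (- P).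
Proof.
move=> /pauliSP [A [B [hA hB ->]]]; rewrite (_ : - _ = (- A) ⊗ B); last by rewrite tensorNl.
by apply: pauli_cons => //; apply: pauli1N.
Qed.

Lemma pauli_comm n (P Q : qmat R n n) : pauli P -> pauli Q ->
  exists s : bool, Q *m P = (-1) ^+ s *: (P *m Q).
Proof.
elim: n P Q => [|n ih] P Q.
  by move=> -> ->; exists false; rewrite scale1r.
move=> /pauliSP [A [B [hA hB ->]]] /pauliSP [A' [B' [hA' hB' ->]]].
have [s hs] := pauli1_comm hA hA'; have [t ht] := ih _ _ hB hB'.
exists (s (+) t); rewrite !mul_tensorS hs ht.
by rewrite tensorZl tensorZr scalerA signr_addb.
Qed.

Lemma pauli_tensor m n (P : qmat R m m) (Q : qmat R n n) :
  pauli P -> pauli Q -> pauli (P ⊗ Q).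
Proof.
elim: m P => [|m ih] P; first by move=> -> hQ; rewrite tensor1l.
move=> /pauliSP [A [B [hA hB ->]]] hQ.
have -> : (A ⊗ B : qmat R m.+1 m.+1) ⊗ Q = A ⊗ (B ⊗ Q) :> qmat R (m + n).+1 (m + n).+1.
  pose e := erefl (2 ^ (m + n).+1)%N; have h := @tensorA R 1 1 m m n n e e A B Q.
  by rewrite -h castmx_id.
by apply: pauli_cons => //; apply: ih.
Qed.

Lemma pauli1_pauli (A : qmat R 1 1) : pauli1 A -> pauli A.
Proof.
move=> hA; exists A, 1%:M; split=> //; apply/matrixP=> i j.
rewrite !(castmxE, mxE) /= !ord1 /= mulr1; congr (A _ _); apply: val_inj => /=.
  by rewrite divn1.
by rewrite divn1.
Qed.

(** If no factor of [P] flips its bit, |0...0> is an eigenvector. Otherwise Z on a flipped qubit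
    fixes |0...0> and anticommutes with [P]. *)
Lemma pauli_ket0s n (P : qmat R n n) : pauli P ->
  (exists w, P *m ket0s n = w *: ket0s n) \/
  (exists Z : qmat R n n, [/\ pauli Z, Z *m ket0s n = ket0s n, Z ^t* = Z,
     Z *m Z = 1%:M & Z *m P = - (P *m Z)]).
Proof.
elim: n P => [|n ih] P.
  by move=> ->; left; exists 1; rewrite mul1mx scale1r.
move=> /pauliSP [A [B [hA hB ->]]].
have [k [[] [b eA]]] := (pauli1P A).1 hA; last first.
  have [[w hw]|[Z [hZ Z0 Zh ZZ ZB]]] := ih _ hB.
    left; exists ('i%C ^+ k * w); rewrite ket0sS mul_tensorS_ket hw eA -scalemxAl xz_ket.
    by rewrite andbF scale1r tensorZl tensorZr scalerA.
  right; exists ((1%:M : qmat R 1 1) ⊗ Z); split.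
  - by apply: pauli_cons => //; constructor.
  - by rewrite ket0sS mul_tensorS_ket mul1mx Z0.
  - by rewrite adj_tensorS adjmx1 Zh.
  - by rewrite mul_tensorS mulmx1 ZZ tensorS1.
  rewrite mul_tensorS mul_tensorS ZB mulmx1 mul1mx.
  by rewrite tensorNr.
right; exists (xz false true ⊗ (1%:M : qmat R n n)); split.
- by apply: pauli_cons; [rewrite -pauliZ_xz; constructor|exact: pauli_one].
- by rewrite ket0sS mul_tensorS_ket mul1mx xz_ket scale1r.
- by rewrite adj_tensorS adjmx1 xz_adj scale1r.
- by rewrite mul_tensorS mulmx1 xzM scale1r xz00 tensorS1.
rewrite mul_tensorS mul_tensorS mulmx1 mul1mx eA.
rewrite -scalemxAl -scalemxAr !xzM andbF scale1r scaleN1r scalerN tensorNl.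
by rewrite addbF [b (+) true]addbC.
Qed.

End PauliGroup.

(** * Clifford unitaries and Pauli projections of stabilizer states *)

Section Clifford.
Context {R : realType}.

Lemma clifford_conj n (V P : qmat R n n) :
  clifford V -> pauli P -> pauli (V *m P *m V ^t*).
Proof. by move=> [_ eV] hP; rewrite -eV; exists P. Qed.

Lemma clifford_adjK n (V : qmat R n n) : clifford V -> V ^t* *m V = 1%:M.
Proof. by move=> [/unitarymxP /mulmx1C]. Qed.

Lemma clifford_conjV n (V P : qmat R n n) :
  clifford V -> pauli P -> pauli (V ^t* *m P *m V).
Proof.
move=> hV; have VV := clifford_adjK hV; case: hV => _ eV.
rewrite -{1}eV => -[Q hQ <-].
by rewrite !mulmxA VV mul1mx -mulmxA VV mulmx1.
Qed.

Lemma clifford_intro n (V : qmat R n n) :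
  V ^t* *m V = 1%:M ->
  (forall P, pauli P -> pauli (V *m P *m V ^t*)) ->
  (forall P, pauli P -> pauli (V ^t* *m P *m V)) -> clifford V.
Proof.
move=> VV h1 h2; have VV' := mulmx1C VV; split; first exact/unitarymxP.
apply/seteqP; split=> [_ [P hP <-]|P hP]; first exact: h1.
exists (V ^t* *m P *m V); first exact: h2.
by rewrite !mulmxA VV' mul1mx -mulmxA VV' mulmx1.
Qed.

Lemma clifford_mul n (U V : qmat R n n) :
  clifford U -> clifford V -> clifford (U *m V).
Proof.
move=> hU hV; apply: clifford_intro => [|P hP|P hP].
- rewrite adjmxM -mulmxA [U ^t* *m _]mulmxA clifford_adjK // mul1mx.
  exact: clifford_adjK.
- rewrite (_ : _ *m _ = U *m (V *m P *m V ^t*) *m U ^t*); last by rewrite adjmxM !mulmxA.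
  by apply: clifford_conj => //; apply: clifford_conj.
rewrite (_ : _ *m _ = V ^t* *m (U ^t* *m P *m U) *m V); last by rewrite adjmxM !mulmxA.
by apply: clifford_conjV => //; apply: clifford_conjV.
Qed.

Lemma scale_half_double m p (A : 'M[R[i]]_(m, p)) : 2^-1 *: (A + A) = A.
Proof. by rewrite scalerDr -scalerDl -[2^-1]mul1r -splitr scale1r. Qed.

(* Conjugation by the rotation (1 + S) / sqrt 2 fixes the Paulis commuting with S
   and sends the anticommuting ones to - P S. *)
Lemma rot_conj n (S P : qmat R n.+1 n.+1) : pauli S -> S *m S = - 1%:M ->
  pauli P -> pauli (2^-1 *: ((1%:M + S) *m P *m (1%:M - S))).
Proof.
move=> hS SS hP; have [[] hc] := pauli_comm hP hS.
  rewrite expr1 scaleN1r in hc.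
  have eS : (1%:M - S) *m (1%:M - S) = - (S + S).
    rewrite mulmxBl !mulmxBr !mulmx1 mul1mx SS opprK opprD.
    by rewrite addrA addrC !addrA addNr add0r opprD.
  rewrite mulmxDl hc mul1mx -[P in P - _]mulmx1 -mulmxBr -mulmxA eS mulmxN.
  rewrite mulmxDr scalerN scale_half_double.
  by apply: pauliN; apply: pauliM.
rewrite expr0 scale1r in hc.
have eS : (1%:M + S) *m (1%:M - S) = 1%:M + 1%:M.
  by rewrite mulmxDl !mulmxBr !mulmx1 mul1mx SS opprK addrA addrNK.
rewrite mulmxDl hc mul1mx -[P in P + _]mulmx1 -mulmxDr -mulmxA eS.
by rewrite mulmxDr mulmx1 scale_half_double.
Qed.

Lemma conj_sqrt2V : ((sqrtC 2 : R[i])^-1) ^* = (sqrtC 2)^-1.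
Proof. by apply/CrealP; rewrite rpredV ger0_real // sqrtC_ge0 ler0n. Qed.

Lemma sqrt2V_sqr : (sqrtC 2 : R[i])^-1 * (sqrtC 2)^-1 = 2^-1.
Proof. by rewrite -invfM -expr2 sqrtCK. Qed.

(** A unitary S with S^2 = -1 is skew-adjoint, so the inverse rotation is the one for -S and
    [rot_conj] serves in both directions. *)
Lemma clifford_rot n (S : qmat R n.+1 n.+1) : pauli S -> S *m S = - 1%:M ->
  clifford ((sqrtC 2)^-1 *: (1%:M + S)).
Proof.
move=> hS SS; have eS : S ^t* = - S.
  rewrite -[LHS]mulmx1 -[1%:M]opprK -SS mulmxN mulmxA pauli_unitary //.
  by rewrite mul1mx.
have hNS : pauli (- S) by apply: pauliN.
have NSS : - S *m - S = - 1%:M by rewrite mulmxN mulNmx opprK.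
have eV : ((sqrtC 2)^-1 *: (1%:M + S)) ^t* = (sqrtC 2)^-1 *: (1%:M - S).
  by rewrite adjmxZ conj_sqrt2V adjmxD adjmx1 eS.
apply: clifford_intro; rewrite eV.
- rewrite -scalemxAl -scalemxAr scalerA sqrt2V_sqr mulmxBl !mulmxDr !mulmx1.
  by rewrite mul1mx SS opprD opprK addrA addrK scale_half_double.
- move=> P hP; rewrite -!scalemxAl -scalemxAr scalerA sqrt2V_sqr.
  exact: rot_conj.
move=> P hP; rewrite -!scalemxAl -scalemxAr scalerA sqrt2V_sqr.
by have := rot_conj hNS NSS hP; rewrite opprK.
Qed.

Lemma dot_ket0s n : dot (ket0s n : qmat R n 0) (ket0s n) = 1.
Proof.
elim: n => [|n ih]; first by rewrite /dot adjmx1 mulmx1 mxtrace1.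
by rewrite [LHS](dot_tensor (ket false) (ket false) (ket0s n) (ket0s n)) ih dot_ket mulr1.
Qed.

Lemma pure_stabilizer_dot n (phi : qmat R n 0) :
  pure_stabilizer phi -> dot phi phi = 1.
Proof.
move=> [U [c [hU hc ->]]]; rewrite dotZl dotZr mulrA [_ * c]mulrC -normCK hc expr1n.
by rewrite mul1r dot_mul mulmxA clifford_adjK // mul1mx dot_ket0s.
Qed.

(* After conjugation by the Clifford preparing [phi], one projects |0...0>; if it
   is not an eigenvector of P, some Z_j anticommutes with P and the rotation
   (1 + P Z_j) / sqrt 2 prepares the normalised projection. *)
Lemma pure_stabilizer_pauli n (P : qmat R n.+1 n.+1) phi :
  pauli P -> P *m P = 1%:M -> pure_stabilizer phi ->
  exists c phi', pure_stabilizer phi' /\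
    2^-1 *: (1%:M + P) *m phi = c *: phi'.
Proof.
move=> hP PP [U [c [hU hc ->]]].
pose Q := U ^t* *m P *m U; have hQ : pauli Q by apply: clifford_conjV.
have UU := mulmx1C (clifford_adjK hU).
have QQ : Q *m Q = 1%:M.
  rewrite /Q !mulmxA -[_ *m U *m U ^t*]mulmxA UU mulmx1 -[_ *m P *m P]mulmxA PP.
  by rewrite mulmx1 clifford_adjK.
have PU : (1%:M + P) *m (c *: (U *m ket0s n.+1)) =
    c *: (U *m ((1%:M + Q) *m ket0s n.+1)).
  rewrite -scalemxAr; congr (_ *: _); rewrite !mulmxA; congr (_ *m _).
  by rewrite mulmxDl mulmxDr mul1mx mulmx1 /Q !mulmxA UU mul1mx.
clearbody Q; have [[w hw]|[Z [hZ Z0 Zh ZZ ZQ]]] := pauli_ket0s hQ.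
  (* A vanishing projection is included: for w = -1 the scalar is 0 and the state itself is the
     witness. *)
  exists (2^-1 * (1 + w)), (c *: (U *m ket0s n.+1)); split; first by exists U, c.
  rewrite -scalemxAl PU mulmxDl mul1mx hw -[X in X + _]scale1r -scalerDl.
  by rewrite -scalemxAr -!scalerA [c *: _]scalerA [(1 + w) *: _]scalerA mulrC.
pose S := Q *m Z.
have hS : pauli S by apply: pauliM.
have SS : S *m S = - 1%:M.
  by rewrite /S !mulmxA -[Q *m Z *m Q]mulmxA ZQ mulmxN mulmxA QQ mul1mx mulNmx ZZ.
exists (2^-1 * sqrtC 2), (c *: (U *m ((sqrtC 2)^-1 *: (1%:M + S)) *m ket0s n.+1)); split.
  exists (U *m ((sqrtC 2)^-1 *: (1%:M + S))), c; split=> //.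
  exact: clifford_mul hU (clifford_rot hS SS).
have S0 : (1%:M + S) *m ket0s n.+1 = (1%:M + Q) *m ket0s n.+1.
  by rewrite !mulmxDl /S -mulmxA Z0.
rewrite -scalemxAl PU -[RHS]scalerA; congr (_ *: _).
rewrite -scalemxAr -scalemxAl -mulmxA S0 !scalerA; congr (_ *: _).
by rewrite mulrAC divff ?mul1r // sqrtC_eq0 pnatr_eq0.
Qed.

End Clifford.

(** * Channels with stabilizer-preserving Kraus operators *)

Section Kraus.
Context {R : realType}.

Lemma block_sum n k (rho : qmat R (n + k) (n + k)) :
  \sum_(a < 2 ^ k) \sum_(b < 2 ^ k)
    (block rho a b) ⊗ (delta_mx a b : qmat R k k) = rho.
Proof.
apply/matrixP=> i j; rewrite summxE.
set i' := cast_ord (expnD 2 n k) i; set j' := cast_ord (expnD 2 n k) j.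
pose i2 := (mxtens_unindex i').2; pose j2 := (mxtens_unindex j').2.
rewrite (bigD1 i2) //= [X in _ + X]big1 ?addr0 => [|a ai]; last first.
  rewrite summxE big1 // => b _; rewrite castmxE !esymK !mxE [_ == a]eq_sym (negPf ai).
  by rewrite mulr0.
rewrite summxE (bigD1 j2) //= [X in _ + X]big1 ?addr0 => [|b bj]; last first.
  by rewrite castmxE !esymK !mxE [_ == b]eq_sym (negPf bj) andbF mulr0.
rewrite castmxE !esymK !mxE -/i' -/j' !eqxx mulr1 castmxE.
by congr (rho _ _); rewrite -[RHS](cast_ordK (expnD 2 n k))
  -[in RHS](mxtens_unindexK (cast_ord _ _)) /=; congr cast_ord; apply: val_inj.
Qed.

(** Expanding [rho] into its blocks reduces the claim to product operators, on which K ⊗ 1 acts on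
    the first factor only. *)
Lemma ampliation_kraus n m k (I : finType) (K : I -> qmat R m n) E
    (rho : qmat R (n + k) (n + k)) :
  (forall rho, E rho = \sum_i K i *m rho *m (K i) ^t*) ->
  ampliation E rho = \sum_i (K i ⊗ (1%:M : qmat R k k)) *m rho
                              *m (K i ⊗ (1%:M : qmat R k k)) ^t*.
Proof.
move=> hE; rewrite /ampliation.
under [RHS]eq_bigr => i _.
  rewrite -[X in _ *m X *m _]block_sum mulmx_sumr mulmx_suml.
  under eq_bigr => a _.
    rewrite mulmx_sumr mulmx_suml.
    under eq_bigr => b _.
      rewrite adjmx_tensor adjmx1 !tensor_mul mul1mx mulmx1.
    over.
  over.
over.
rewrite [RHS]exchange_big; apply: eq_bigr => a _ /=.
rewrite [RHS]exchange_big; apply: eq_bigr => b _ /=.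
by rewrite hE tensor_suml.
Qed.

(** Meant for mixtures indexed by pairs of a Kraus operator and a component of the input. *)
Lemma stabilizer_state_fin n (T : finType) (p : T -> R) (psi : T -> qmat R n 0) :
  (forall t, 0 <= p t) -> \sum_t p t = 1 ->
  (forall t, pure_stabilizer (psi t)) ->
  stabilizer_state (\sum_t (p t)%:C *: proj (psi t)).
Proof.
move=> p0 p1 hpsi; exists #|T|, (p \o enum_val), (psi \o enum_val); split=> //=.
- by rewrite -p1 -(big_enum_val (A := T) p).
by rewrite -(big_enum_val (A := T) (fun t => (p t)%:C *: proj (psi t))).
Qed.

Lemma trace_proj n (psi : qmat R n 0) : \tr (proj psi) = dot psi psi.
Proof. by rewrite /proj mxtrace_mulC. Qed.

Lemma proj_mul m n (A : qmat R m n) (psi : qmat R n 0) :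
  A *m proj psi *m A ^t* = proj (A *m psi).
Proof. by rewrite /proj adjmxM !mulmxA. Qed.

Lemma projZ n c (psi : qmat R n 0) : proj (c *: psi) = `|c| ^+ 2 *: proj psi.
Proof. by rewrite /proj adjmxZ -scalemxAl -scalemxAr scalerA normCK. Qed.

(** A Kraus operator sends a component of weight p to c phi', which contributes phi' with weight p
    |c|^2. Trace preservation makes these weights sum to 1. *)
Lemma kraus_CSPO n (I : finType) (K : I -> qmat R n n) E :
  (forall rho, E rho = \sum_i K i *m rho *m (K i) ^t*) ->
  \sum_i (K i) ^t* *m K i = 1%:M ->
  (forall i k (phi : qmat R (n + k) 0), pure_stabilizer phi ->
    exists c phi', pure_stabilizer phi' /\
      (K i ⊗ (1%:M : qmat R k k)) *m phi = c *: phi') ->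
  CSPO E.
Proof.
move=> hE K1 hK.
have trE k (rho : qmat R (n + k) (n + k)) : \tr (ampliation E rho) = \tr rho.
  rewrite (ampliation_kraus _ hE) raddf_sum /=.
  under eq_bigr => i _ do
    rewrite mxtrace_mulC mulmxA adjmx_tensor adjmx1 tensor_mul mulmx1.
  by rewrite -raddf_sum -mulmx_suml -tensor_suml K1 tensor1 mul1mx.
split; first split.
- move=> a u v; rewrite !hE scaler_sumr -big_split; apply: eq_bigr => i _ /=.
  by rewrite mulmxDr mulmxDl -scalemxAr -scalemxAl.
(* Each term is the quadratic form of [rho] at the vector obtained from [v] by the adjoint Kraus
   operator. *)
- move=> k rho h v; rewrite (ampliation_kraus _ hE) mulmx_sumr mulmx_suml raddf_sum.
  rewrite sumr_ge0 // => i _.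
  set L := K i ⊗ _; have := h (L ^t* *m v).
  by rewrite adjmxM adjmxK !mulmxA.
- move=> rho; rewrite hE raddf_sum /=.
  under eq_bigr => i _ do rewrite mxtrace_mulC mulmxA.
  by rewrite -raddf_sum -mulmx_suml K1 mul1mx.
move=> k rho hrho; have trr := trE k rho.
have [N [p [psi [p0 p1 hpsi erho]]]] := hrho.
have /boolp.choice [f hf] (x : I * 'I_N) : exists y : R[i] * qmat R (n + k) 0,
    pure_stabilizer y.2 /\
    (K x.1 ⊗ (1%:M : qmat R k k)) *m psi x.2 = y.1 *: y.2.
  by have [c [phi [h1 h2]]] := hK x.1 k _ (hpsi x.2); exists (c, phi).
(* Weights have to lie in [R], hence the real-valued modulus. *)
pose q x := p x.2 * Normc.normc (f x).1 ^+ 2.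
have eq x : (q x)%:C = (p x.2)%:C * `|(f x).1| ^+ 2.
  by rewrite rmorphM rmorphXn.
have eA : ampliation E rho = \sum_x (q x)%:C *: proj (f x).2.
  rewrite (ampliation_kraus _ hE) erho.
  transitivity (\sum_i \sum_j (q (i, j))%:C *: proj (f (i, j)).2); last first.
    by rewrite pair_bigA; apply: eq_bigr => -[i j].
  apply: eq_bigr => i _; rewrite mulmx_sumr mulmx_suml; apply: eq_bigr => j _ /=.
  rewrite eq /= -scalemxAr -scalemxAl -scalerA; congr (_ *: _).
  by rewrite proj_mul; have [_ /= ->] := hf (i, j); rewrite projZ.
rewrite eA; apply: stabilizer_state_fin.
- by move=> x; rewrite mulr_ge0 ?sqr_ge0.
(* The sum of the weights is read off the trace, since pure stabilizer states have norm 1. *)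
- apply: (@complexI R); rewrite -[RHS]/((1 : R)%:C) -p1 !rmorph_sum /=.
  transitivity (\tr (ampliation E rho)).
    rewrite eA raddf_sum; apply: eq_bigr => x _ /=.
    by rewrite mxtraceZ trace_proj pure_stabilizer_dot ?mulr1 //; have [] := hf x.
  rewrite trr erho raddf_sum; apply: eq_bigr => j _ /=.
  by rewrite mxtraceZ trace_proj pure_stabilizer_dot ?mulr1.
by move=> x; have [] := hf x.
Qed.

End Kraus.

(** * The Kraus operators of the channel *)

Section ThreeQubits.
Context {R : realType}.
Notation ket := (@ket R).
Notation ket_plus := (@ket_plus R).

Definition ket3 (u v w : qmat R 1 0) : qmat R 3 0 := u ⊗ v ⊗ w.
Definition op3 (A B C : qmat R 1 1) : qmat R 3 3 := A ⊗ B ⊗ C.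

Lemma dot_ket3 u v w u' v' w' :
  dot (ket3 u v w) (ket3 u' v' w') = dot u u' * dot v v' * dot w w'.
Proof.
rewrite -(dot_tensor u u' v v').
exact: (dot_tensor (u ⊗ v : qmat R 2 0) (u' ⊗ v' : qmat R 2 0) w w').
Qed.

Lemma op3_ket A B C u v w :
  op3 A B C *m ket3 u v w = ket3 (A *m u) (B *m v) (C *m w).
Proof.
rewrite [RHS]/ket3 -(tensor_mul A B u v).
exact: (tensor_mul (A ⊗ B) C (u ⊗ v) w).
Qed.

Lemma op3M A B C A' B' C' :
  op3 A B C *m op3 A' B' C' = op3 (A *m A') (B *m B') (C *m C').
Proof.
rewrite [RHS]/op3 -(tensor_mul A B A' B').
exact: (tensor_mul (A ⊗ B) C (A' ⊗ B') C').
Qed.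

Lemma op3_1 : op3 1%:M 1%:M 1%:M = 1%:M.
Proof. rewrite /op3 (tensor1 1 1); exact: (tensor1 2 1). Qed.

Lemma proj_ket3 u v w : proj (ket3 u v w) = op3 (proj u) (proj v) (proj w).
Proof.
rewrite /proj.
have -> : (ket3 u v w) ^t* = ((u ^t* ⊗ v ^t*) ⊗ w ^t* : qmat R 0 3).
  rewrite /ket3 -(adjmx_tensor u v); exact: (adjmx_tensor (u ⊗ v) w).
rewrite /op3 -(tensor_mul u v (u ^t*) (v ^t*)).
exact: (tensor_mul (u ⊗ v) w (u ^t* ⊗ v ^t*) (w ^t*)).
Qed.

Lemma op3_Dl A A' B C : op3 (A + A') B C = op3 A B C + op3 A' B C.
Proof. by rewrite /op3 tensorDl; apply: (@tensorDl _ 2 2). Qed.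
Lemma op3_Dm A B B' C : op3 A (B + B') C = op3 A B C + op3 A B' C.
Proof. by rewrite /op3 tensorDr; apply: (@tensorDl _ 2 2). Qed.
Lemma op3_Dr A B C C' : op3 A B (C + C') = op3 A B C + op3 A B C'.
Proof. exact: (@tensorDr _ 2 2). Qed.
Lemma op3_Zl a A B C : op3 (a *: A) B C = a *: op3 A B C.
Proof. by rewrite /op3 tensorZl; apply: (@tensorZl _ 2 2). Qed.
Lemma op3_Zm a A B C : op3 A (a *: B) C = a *: op3 A B C.
Proof. by rewrite /op3 tensorZr; apply: (@tensorZl _ 2 2). Qed.
Lemma op3_Zr a A B C : op3 A B (a *: C) = a *: op3 A B C.
Proof. exact: (@tensorZr _ 2 2). Qed.
Lemma ket3_Dl u u' v w : ket3 (u + u') v w = ket3 u v w + ket3 u' v w.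
Proof. by rewrite /ket3 tensorDl; apply: (@tensorDl _ 2 0). Qed.
Lemma ket3_Zl a u v w : ket3 (a *: u) v w = a *: ket3 u v w.
Proof. by rewrite /ket3 tensorZl; apply: (@tensorZl _ 2 0). Qed.
Lemma ket3_Zm a u v w : ket3 u (a *: v) w = a *: ket3 u v w.
Proof. by rewrite /ket3 tensorZr; apply: (@tensorZl _ 2 0). Qed.
Lemma ket3_Zr a u v w : ket3 u v (a *: w) = a *: ket3 u v w.
Proof. exact: (@tensorZr _ 2 0). Qed.

Definition op3D := (op3_Dl, op3_Dm, op3_Dr).
Definition op3Z := (op3_Zl, op3_Zm, op3_Zr).

Lemma pauli_op3 A B C : pauli1 A -> pauli1 B -> pauli1 C -> pauli (op3 A B C).
Proof.
move=> hA hB hC; apply: (@pauli_tensor _ 2 1); last exact: pauli1_pauli.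
by apply: (@pauli_tensor _ 1 1); apply: pauli1_pauli.
Qed.

(** [pauli] associates to the right and ends in a zero-qubit factor, while [op3] associates to the
    left: the factor is dropped and [tensorA] regroups. *)
Lemma pauli3P (P : qmat R 3 3) : pauli P ->
  exists A B C, [/\ pauli1 A, pauli1 B, pauli1 C & P = op3 A B C].
Proof.
move=> /pauliSP [A [P' [hA /pauliSP [B [P'' [hB /pauliSP [C [P0 [hC P01 ->]]] ->]]] ->]]].
exists A, B, C; split=> //.
have -> : P0 = 1%:M by exact: P01.
have -> : C ⊗ (1%:M : qmat R 0 0) = C :> qmat R 1 1.
  apply/matrixP=> i j.
  rewrite !(castmxE, mxE) /= !ord1 /= mulr1; congr (C _ _); apply: val_inj => /=.
    by rewrite divn1.
  by rewrite divn1.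
have h := @tensorA R 1 1 1 1 1 1 (erefl (2 ^ 3)%N) (erefl (2 ^ 3)%N) A B C.
by rewrite /op3; move: h; rewrite castmx_id => ->.
Qed.

Lemma dot_ket_plus s t : dot (ket_plus s) (ket_plus t) = (s == t)%:R.
Proof.
rewrite /ket_plus dotZl dotZr conj_sqrt2V mulrA sqrt2V_sqr.
rewrite !(dotDl, dotDr, dotZl, dotZr) !dot_ket rmorph_sign !(mulr0, addr0, add0r) mulr1.
rewrite -signr_addb; case: s; case: t; rewrite /= ?expr0 ?expr1 ?addrN ?mulr0 //.
  by rewrite mulVf ?pnatr_eq0.
by rewrite mulVf ?pnatr_eq0.
Qed.

Lemma dot_ket_ket_plus b s :
  dot (ket b) (ket_plus s) = (sqrtC 2)^-1 * (-1) ^+ (b && s).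
Proof.
rewrite dotZr dotDr dotZr !dot_ket.
by case: b; rewrite /= ?(mulr0, addr0, add0r) ?mulr1.
Qed.

Lemma dot_ket_plus_ket b s :
  dot (ket_plus s) (ket b) = (sqrtC 2)^-1 * (-1) ^+ (b && s).
Proof. by rewrite dotC dot_ket_ket_plus rmorphM rmorph_sign /= conj_sqrt2V. Qed.

Lemma proj_ket_sum : proj (ket false) + proj (ket true) = 1%:M.
Proof. by rewrite -ket_complete big_bool addrC. Qed.

Lemma proj_ketE b : proj (ket b) = 2^-1 *: (1%:M + (-1) ^+ b *: xz false true).
Proof.
apply: ket_ext => c; rewrite /proj -mulmxA ket_bra mul_mx_scalar -scalemxAl.
rewrite mulmxDl mul1mx -scalemxAl xz_ket scalerA -signr_addb.
rewrite -[X in _ *: (X + _)]scale1r -scalerDl scalerA.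
case: b; case: c; rewrite /= ?expr0 ?expr1 ?addrN ?mulr0 ?scale0r // mulVf ?pnatr_eq0 //.
Qed.

Lemma proj_ket_plusE s :
  proj (ket_plus s) = 2^-1 *: (1%:M + (-1) ^+ s *: xz true false).
Proof.
apply: ket_ext => c; rewrite /proj -mulmxA dotE mul_mx_scalar dot_ket_plus_ket.
rewrite scalerA mulrC mulrA sqrt2V_sqr -scalerA -scalemxAl; congr (_ *: _).
rewrite mulmxDl mul1mx -scalemxAl xz_ket scalerDr scalerA -signr_addb.
by case: s; case: c; rewrite /= ?(expr0, expr1, scale1r, scaleN1r, opprK) 1?addrC.
Qed.

Lemma proj_ket_plus_sum : proj (ket_plus false) + proj (ket_plus true) = 1%:M.
Proof.
rewrite [X in _ + X]proj_ket_plusE [X in X + _]proj_ket_plusE -scalerDr.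
apply: etrans (scale_half_double _); congr (_ *: _).
by rewrite expr0 expr1 scale1r scaleN1r addrACA subrr addr0.
Qed.

Lemma sum6 (V : nmodType) (f : nat -> V) :
  \sum_(i < 6) f i = f 0%N + f 1%N + f 2%N + f 3%N + f 4%N + f 5%N.
Proof. by rewrite !big_ord_recr big_ord0 /= add0r. Qed.

Definition psi_seq : seq (qmat R 3 0) :=
  [:: ket3 (ket_plus false) (ket true) (ket false);
      ket3 (ket false) (ket_plus false) (ket true);
      ket3 (ket true) (ket false) (ket_plus false);
      ket3 (ket_plus true) (ket true) (ket false);
      ket3 (ket false) (ket_plus true) (ket true);
      ket3 (ket true) (ket false) (ket_plus true)].

Lemma psi_nth mu : psi mu = nth 0 psi_seq mu.
Proof. by rewrite /psi (tnth_nth 0). Qed.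

(** The six terms pair up through p0 + p1 = 1 into three with an identity in one slot. Written as P0
    + P1, these cover the six bit strings other than 000 and 111. *)
Lemma op3_resolution (P0 P1 p0 p1 : qmat R 1 1) :
  P0 + P1 = 1%:M -> p0 + p1 = 1%:M ->
  1%:M - (op3 p0 P1 P0 + op3 P0 p0 P1 + op3 P1 P0 p0 +
          op3 p1 P1 P0 + op3 P0 p1 P1 + op3 P1 P0 p1) =
  op3 P0 P0 P0 + op3 P1 P1 P1.
Proof.
move=> e1 e2; apply/eqP; rewrite subr_eq; apply/eqP.
transitivity (op3 P0 P0 P0 + op3 P1 P1 P1 + (op3 (p0 + p1) P1 P0 +
  op3 P0 (p0 + p1) P1 + op3 P1 P0 (p0 + p1))); last first.
  rewrite !op3D; move: (op3 p0 P1 P0) (op3 P0 p0 P1) (op3 P1 P0 p0) (op3 p1 P1 P0)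
    (op3 P0 p1 P1) (op3 P1 P0 p1) (op3 P0 P0 P0) (op3 P1 P1 P1) => a b c d f g h l.
  by apply/matrixP=> i j; rewrite !mxE; ring.
rewrite e2 -op3_1 -e1 !op3D.
move: (op3 P0 P1 P0) (op3 P0 P0 P1) (op3 P1 P0 P0) (op3 P1 P1 P0)
  (op3 P0 P1 P1) (op3 P1 P0 P1) (op3 P0 P0 P0) (op3 P1 P1 P1) => a b c d f g h l.
by apply/matrixP=> i j; rewrite !mxE; ring.
Qed.

Lemma cat_proj_psi : 1%:M - \sum_(mu < 6) proj (psi mu) =
  op3 (proj (ket false)) (proj (ket false)) (proj (ket false)) +
  op3 (proj (ket true)) (proj (ket true)) (proj (ket true)).
Proof.
rewrite -(op3_resolution proj_ket_sum proj_ket_plus_sum); congr (_ - _).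
under eq_bigr => mu _ do rewrite psi_nth.
rewrite (sum6 (fun i => proj (nth 0 psi_seq i))).
by do 5![apply: (f_equal2 +%R); last exact: proj_ket3]; exact: proj_ket3.
Qed.

(** The condition of [kraus_CSPO] on one Kraus operator; [c] may be 0, which admits a vanishing
    image. *)
Definition stab_preserving n (A : qmat R n n) :=
  forall k (phi : qmat R (n + k) 0), pure_stabilizer phi ->
    exists c phi', pure_stabilizer phi' /\
      (A ⊗ (1%:M : qmat R k k)) *m phi = c *: phi'.

Lemma stab_preserving_mul n (A B : qmat R n n) :
  stab_preserving A -> stab_preserving B -> stab_preserving (A *m B).
Proof.
move=> hA hB k phi /(hB k) [c [phi' [/(hA k) [d [phi'' [h e']]] e]]].
exists (c * d), phi''; split=> //.
rewrite -[X in _ ⊗ X](mulmx1 1%:M) -tensor_mul -mulmxA e -scalemxAr e'.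
by rewrite scalerA.
Qed.

(** With [k] spectators, P ⊗ 1 is again a Pauli of square 1, so [pure_stabilizer_pauli] applies. *)
Lemma stab_preserving_half n (P : qmat R n.+1 n.+1) :
  pauli P -> P *m P = 1%:M -> stab_preserving (2^-1 *: (1%:M + P)).
Proof.
move=> hP PP k phi hphi.
have hPk : @pauli R (n + k).+1 (P ⊗ (1%:M : qmat R k k)).
  exact: (@pauli_tensor R n.+1 k P 1%:M hP (pauli_one k)).
have PPk : (P ⊗ (1%:M : qmat R k k) : qmat R (n + k).+1 (n + k).+1) *m
   (P ⊗ (1%:M : qmat R k k)) = 1%:M.
  rewrite (tensor_mul P (1%:M : qmat R k k) P 1%:M) PP mulmx1.
  exact: (tensor1 n.+1 k).
have [c [phi' [h e]]] := @pure_stabilizer_pauli R (n + k) _ phi hPk PPk hphi.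
by exists c, phi'; split=> //; rewrite -e tensorZl tensorDl (tensor1 n.+1 k).
Qed.

Lemma xz_sqr a b : ~~ (a && b) -> xz a b *m xz a b = 1%:M :> qmat R 1 1.
Proof. by move=> /negPf ab; rewrite xzM andbC ab !addbb xz00 expr0 scale1r. Qed.

Lemma pauli1_xz a b : pauli1 (xz a b : qmat R 1 1).
Proof. by apply/pauli1P; exists 0, a, b; rewrite scale1r. Qed.

Lemma signed_xz a b (s : bool) : ~~ (a && b) ->
  pauli1 ((-1) ^+ s *: xz a b : qmat R 1 1) /\
  ((-1) ^+ s *: xz a b) *m ((-1) ^+ s *: xz a b) = 1%:M :> qmat R 1 1.
Proof.
move=> ab; split.
  by case: s; rewrite (scale1r, scaleN1r) //; [apply: pauli1N|]; apply: pauli1_xz.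
by rewrite -scalemxAl -scalemxAr scalerA -signr_addb addbb expr0 scale1r xz_sqr.
Qed.

(** Being unitary with square 1, [P] is Hermitian, and [A] is the projector onto its +1
    eigenspace. *)
Definition half_pauli (A : qmat R 1 1) :=
  exists P, [/\ pauli1 P, P *m P = 1%:M & A = 2^-1 *: (1%:M + P)].

Lemma half_pauli_ket b : half_pauli (proj (ket b)).
Proof.
have [h1 h2] := @signed_xz false true b isT.
by exists ((-1) ^+ b *: xz false true); rewrite proj_ketE.
Qed.

Lemma half_pauli_ket_plus s : half_pauli (proj (ket_plus s)).
Proof.
have [h1 h2] := @signed_xz true false s isT.
by exists ((-1) ^+ s *: xz true false); rewrite proj_ket_plusE.
Qed.

Lemma stab_preserving_half3 A B C : pauli1 A -> pauli1 B -> pauli1 C ->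
  A *m A = 1%:M -> B *m B = 1%:M -> C *m C = 1%:M ->
  stab_preserving (2^-1 *: (1%:M + op3 A B C)).
Proof.
move=> hA hB hC AA BB CC; apply: stab_preserving_half; first exact: pauli_op3.
by rewrite op3M AA BB CC op3_1.
Qed.

(** Acting on different qubits, the three factors compose as three Pauli projections. *)
Lemma stab_preserving_op3 A B C : half_pauli A -> half_pauli B -> half_pauli C ->
  stab_preserving (op3 A B C).
Proof.
move=> [P [hP PP eA]] [Q [hQ QQ eB]] [S [hS SS eC]].
have -> : op3 A B C = op3 A 1%:M 1%:M *m op3 1%:M B 1%:M *m op3 1%:M 1%:M C.
  by rewrite 2!op3M !mulmx1 !mul1mx.
have h1 := @pauli1_1 R; have e1 : 1%:M *m 1%:M = 1%:M :> qmat R 1 1 by rewrite mulmx1.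
apply: stab_preserving_mul; [apply: stab_preserving_mul|].
- by rewrite eA op3_Zl op3_Dl op3_1; apply: stab_preserving_half3.
- by rewrite eB op3_Zm op3_Dm op3_1; apply: stab_preserving_half3.
by rewrite eC op3_Zr op3_Dr op3_1; apply: stab_preserving_half3.
Qed.

Lemma pauliZ_proj : xz false true = proj (ket false) + (-1) *: proj (ket true) :> qmat R 1 1.
Proof. by rewrite scaleN1r -pauliZ_xz. Qed.

(** Substituting Z = P0 - P1 and 1 = P0 + P1 cancels the terms with unequal bits. *)
Lemma op3_parityl : 2^-1 *: (1%:M + op3 (xz false true) (xz false true) 1%:M) =
  op3 (proj (ket false)) (proj (ket false)) 1%:M +
  op3 (proj (ket true)) (proj (ket true)) 1%:M.
Proof.
rewrite pauliZ_proj -op3_1 -{1 2}proj_ket_sum.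
move: (proj (ket false)) (proj (ket true)) => P0 P1.
rewrite -[in RHS](scale_half_double (_ + _)); congr (_ *: _).
rewrite !op3D !op3Z.
move: (op3 P0 P0 1%:M) (op3 P0 P1 1%:M) (op3 P1 P0 1%:M) (op3 P1 P1 1%:M) => a b c d.
by apply/matrixP=> i j; rewrite !mxE; ring.
Qed.

Lemma op3_parityr : 2^-1 *: (1%:M + op3 1%:M (xz false true) (xz false true)) =
  op3 1%:M (proj (ket false)) (proj (ket false)) +
  op3 1%:M (proj (ket true)) (proj (ket true)).
Proof.
rewrite pauliZ_proj -op3_1 -{2 3}proj_ket_sum.
move: (proj (ket false)) (proj (ket true)) => P0 P1.
rewrite -[in RHS](scale_half_double (_ + _)); congr (_ *: _).
rewrite !op3D !op3Z.
move: (op3 1%:M P0 P0) (op3 1%:M P0 P1) (op3 1%:M P1 P0) (op3 1%:M P1 P1) => a b c d.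
by apply/matrixP=> i j; rewrite !mxE; ring.
Qed.

Lemma proj_ketM a b :
  proj (ket a) *m proj (ket b) = ket a *m ((a == b)%:R *: (ket b) ^t*).
Proof.
have -> : proj (ket a) *m proj (ket b) = ket a *m (((ket a) ^t* *m ket b) *m (ket b) ^t*).
  by rewrite !mulmxA.
by rewrite ket_bra mul_scalar_mx.
Qed.

Lemma proj_ket_idem b : proj (ket b) *m proj (ket b) = proj (ket b).
Proof. by rewrite proj_ketM eqxx scale1r. Qed.

Lemma proj_ket_orth b : proj (ket b) *m proj (ket (~~ b)) = 0.
Proof. by rewrite proj_ketM (_ : _ == _ = false) ?scale0r ?mulmx0 //; case: b. Qed.

(* The last Kraus operator of [psi_channel]; it is the product of the projectors
   onto the +1 eigenspaces of Z Z 1 and 1 Z Z. *)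
Definition cat_proj : qmat R 3 3 :=
  op3 (proj (ket false)) (proj (ket false)) (proj (ket false)) +
  op3 (proj (ket true)) (proj (ket true)) (proj (ket true)).

Lemma op3_0m (A C : qmat R 1 1) : op3 A 0 C = 0.
Proof. by rewrite -(scale0r (0 : qmat R 1 1)) op3_Zm scale0r. Qed.

Lemma cat_projE : cat_proj =
  2^-1 *: (1%:M + op3 (xz false true) (xz false true) 1%:M) *m
  (2^-1 *: (1%:M + op3 1%:M (xz false true) (xz false true))).
Proof.
rewrite [X in _ = X *m _]op3_parityl [X in _ = _ *m X]op3_parityr /cat_proj.
move: (proj_ket_idem false) (proj_ket_idem true) (proj_ket_orth false) (proj_ket_orth true).
rewrite [~~ false]/= [~~ true]/=.
move: (proj (ket false)) (proj (ket true)) => P0 P1 e0 e1 e01 e10.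
rewrite mulmxDl !mulmxDr !op3M !mul1mx !mulmx1 e0 e1 e01 e10.
by rewrite !op3_0m addr0 add0r.
Qed.

Lemma stab_preserving_cat : stab_preserving cat_proj.
Proof.
have h1 := @pauli1_1 R; have e1 : 1%:M *m 1%:M = 1%:M :> qmat R 1 1 by rewrite mulmx1.
have hZ := pauli1_xz false true; have ZZ := @xz_sqr false true isT.
by rewrite cat_projE; apply: stab_preserving_mul; apply: stab_preserving_half3.
Qed.

Lemma cat_proj_idem : cat_proj *m cat_proj = cat_proj.
Proof.
rewrite /cat_proj.
move: (proj_ket_idem false) (proj_ket_idem true) (proj_ket_orth false) (proj_ket_orth true).
rewrite [~~ false]/= [~~ true]/=.
move: (proj (ket false)) (proj (ket true)) => P0 P1 e0 e1 e01 e10.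
rewrite mulmxDl !mulmxDr !op3M e0 e1 e01 e10.
by rewrite !op3_0m addr0 add0r.
Qed.

End ThreeQubits.

(** * The orthonormal basis containing the six product states *)

Section Basis.
Context {R : realType}.

(* [(false, b)] stands for |b>, [(true, b)] for |+> (b = false) or |-> (b = true). *)
Definition qubit (x : bool * bool) : qmat R 1 0 :=
  if x.1 then ket_plus x.2 else ket x.2.
(** Vectors of different bases always overlap, so only labels of the same basis can be orthogonal.
    Orthogonality thus becomes a boolean computation. *)
Definition qubit_orth (x y : bool * bool) := (x.1 == y.1) && (x.2 != y.2).

Definition label := (bool * bool * (bool * bool) * (bool * bool))%type.
Definition qubits (x : label) : qmat R 3 0 :=
  ket3 (qubit x.1.1) (qubit x.1.2) (qubit x.2).
Definition orth (x y : label) :=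
  [|| qubit_orth x.1.1 y.1.1, qubit_orth x.1.2 y.1.2 | qubit_orth x.2 y.2].

Lemma sqrt2V_neq0 : (sqrtC 2 : R[i])^-1 != 0.
Proof. by rewrite invr_eq0 sqrtC_eq0 pnatr_eq0. Qed.

Lemma dot_qubit_eq0 x y : (dot (qubit x) (qubit y) == 0) = qubit_orth x y.
Proof.
have nz (b : bool) : ((sqrtC 2 : R[i])^-1 * (-1) ^+ b == 0) = false.
  by rewrite mulf_eq0 (negPf sqrt2V_neq0) signr_eq0.
rewrite /qubit /qubit_orth; case: x y => [[] b] [[] c] /=.
- by rewrite dot_ket_plus pnatr_eq0; case: b c => [] [].
- by rewrite dot_ket_plus_ket nz.
- by rewrite dot_ket_ket_plus nz.
by rewrite dot_ket pnatr_eq0; case: b c => [] [].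
Qed.

Lemma dot_qubit_id x : dot (qubit x) (qubit x) = 1.
Proof.
by rewrite /qubit; case: x => [[] b] /=; rewrite (dot_ket, dot_ket_plus) eqxx.
Qed.

Lemma dot_qubits_eq0 x y : (dot (qubits x) (qubits y) == 0) = orth x y.
Proof. by rewrite dot_ket3 !mulf_eq0 !dot_qubit_eq0 -orbA. Qed.

Lemma dot_qubits_id x : dot (qubits x) (qubits x) = 1.
Proof. by rewrite dot_ket3 !dot_qubit_id !mulr1. Qed.

Definition comp (a b c : bool) : label := ((false, a), (false, b), (false, c)).

Definition psi_label : seq label :=
  [:: ((true, false), (false, true), (false, false));
      ((false, false), (true, false), (false, true));
      ((false, true), (false, false), (true, false));
      ((true, true), (false, true), (false, false));
      ((false, false), (true, true), (false, true));
      ((false, true), (false, false), (true, true))].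
(** Eight orthonormal vectors in dimension eight, hence a basis. *)
Definition basis : seq label :=
  psi_label ++ [:: comp false false false; comp true true true].

Lemma psiE (mu : 'I_6) : psi mu = qubits (nth (comp false false false) psi_label mu).
Proof. by rewrite psi_nth; case: mu => [[|[|[|[|[|[|]]]]]] ?]. Qed.

Lemma basis_orth x y : x \in basis -> y \in basis -> x != y -> orth x y.
Proof.
(* All 64 pairs are decided by computation. *)
have /allP h : all (fun x => all (fun y => (x != y) ==> orth x y) basis) basis by [].
by move=> /h /allP hx /hx /implyP.
Qed.

Lemma dot_basis x y : x \in basis -> y \in basis ->
  dot (qubits x) (qubits y) = (x == y)%:R.
Proof.
move=> hx hy; have [->|xy] := eqVneq x y; first by rewrite dot_qubits_id.
by apply/eqP; rewrite dot_qubits_eq0 basis_orth.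
Qed.

Lemma psi_label_basis i : (i < 6)%N -> nth (comp false false false) psi_label i \in basis.
Proof. by move=> hi; rewrite mem_cat mem_nth. Qed.

Lemma proj_mulket n (u v : qmat R n 0) : proj u *m v = dot u v *: u.
Proof. by rewrite /proj -mulmxA dotE mul_mx_scalar. Qed.

Lemma proj_adj n (u : qmat R n 0) : (proj u) ^t* = proj u.
Proof. by rewrite /proj adjmxM adjmxK. Qed.

Lemma sum_proj_psi_ket x : x \in basis ->
  (\sum_(mu < 6) proj (psi mu)) *m qubits x =
  if x \in psi_label then qubits x else 0.
Proof.
move=> hx; rewrite mulmx_suml.
have e (mu : 'I_6) : proj (psi mu) *m qubits x =
    (nth (comp false false false) psi_label mu == x)%:R *: qubits x.
  rewrite proj_mulket.
  rewrite psiE.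
  rewrite dot_basis; [|exact: psi_label_basis|exact: hx].
  case: eqP => [<-|_]; first by [].
  by rewrite !scale0r.
rewrite (eq_bigr _ (fun mu _ => e mu)) -scaler_suml.
case: ifP => hp; last first.
  rewrite big1 ?scale0r // => mu _; case: eqP => // h.
  by rewrite -h mem_nth in hp.
have ix : (index x psi_label < 6)%N by rewrite index_mem.
rewrite (bigD1 (Ordinal ix)) //= nth_index // eqxx big1 ?addr0 ?scale1r // => mu mux.
case: (_ =P x) => // ex; case/eqP: mux; apply: val_inj.
transitivity (index x psi_label); last by [].
by rewrite -ex index_uniq.
Qed.

Lemma cat_proj_ket x : x \in basis ->
  cat_proj *m qubits x = if x \in psi_label then 0 else qubits x.
Proof.
move=> hx; rewrite -[cat_proj]cat_proj_psi mulmxBl mul1mx sum_proj_psi_ket //.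
by case: ifP; rewrite ?subrr ?subr0.
Qed.

Lemma cat_proj_adj : (cat_proj : qmat R 3 3) ^t* = cat_proj.
Proof.
rewrite -[cat_proj]cat_proj_psi adjmxB adjmx1 adjmx_sum; congr (_ - _).
by apply: eq_bigr => mu _; rewrite proj_adj.
Qed.

(** Index 0 carries [cat_proj], and [lift ord0 mu] the projector onto [psi mu]. *)
Definition psi_kraus (i : 'I_7) : qmat R 3 3 :=
  if unlift ord0 i is Some mu then proj (psi mu) else cat_proj.

Lemma psi_channel_kraus rho :
  psi_channel rho = \sum_i psi_kraus i *m rho *m (psi_kraus i) ^t*.
Proof.
rewrite big_ord_recl /psi_channel addrC.
congr (_ + _).
  by rewrite /psi_kraus unlift_none cat_proj_adj -[cat_proj]cat_proj_psi.
by apply: eq_bigr => mu _; rewrite /psi_kraus liftK proj_adj.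
Qed.

Lemma psi_kraus_unit : \sum_i (psi_kraus i) ^t* *m psi_kraus i = 1%:M.
Proof.
rewrite big_ord_recl {1 2}/psi_kraus unlift_none cat_proj_adj cat_proj_idem.
rewrite -[cat_proj]cat_proj_psi -[RHS](subrK (\sum_(mu < 6) proj (psi mu))); congr (_ + _).
apply: eq_bigr => mu _; rewrite /psi_kraus liftK proj_adj.
by rewrite [X in _ *m X]/proj mulmxA proj_mulket psiE dot_qubits_id scale1r.
Qed.

Lemma psi_channel_CSPO : CSPO (@psi_channel R).
Proof.
apply: (kraus_CSPO psi_channel_kraus psi_kraus_unit) => i.
rewrite -/(stab_preserving (psi_kraus i)) /psi_kraus.
case: unliftP => [mu _|_]; last exact: stab_preserving_cat.
have h x : half_pauli (proj (qubit x)).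
  by rewrite /qubit; case: x.1; [apply: half_pauli_ket_plus|apply: half_pauli_ket].
by rewrite psiE proj_ket3; apply: stab_preserving_op3; apply: h.
Qed.
End Basis.

(** * Kraus operators of stabilizer protocols *)

Section Insertion.
Context {R : realType}.

(* What the argument uses of the isometry V inserting a qubit in state |b>, with
   Z the Pauli Z of that qubit. *)
Definition insertion m n (Z : qmat R m m) (b : bool) (V : qmat R m n) :=
  [/\ V ^t* *m V = 1%:M,
      V *m V ^t* = 2^-1 *: (1%:M + (-1) ^+ b *: Z),
      forall P, pauli P ->
        (exists c P', pauli P' /\ P *m V = c *: (V *m P')) \/ V ^t* *m P *m V = 0 &
      forall P', pauli P' ->
        exists P, [/\ pauli P, P *m V = V *m P' & V ^t* *m P = P' *m V ^t*]].

(** The sizes [1 + n] and [0 + n] fit the tensor lemmas. A diagonal first factor of a Pauli acts on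
    |b> as a scalar; an antidiagonal one has no diagonal entry at b. *)
Lemma insertion_here n b :
  @insertion (1 + n) (0 + n) (xz false true ⊗ (1%:M : qmat R n n)) b
    (ket b ⊗ (1%:M : qmat R n n)).
Proof.
split.
- by rewrite adjmx_tensor adjmx1 tensor_mul ket_bra eqxx mulmx1 (tensor1 0 n).
- rewrite adjmx_tensor adjmx1 tensor_mul mulmx1 -[X in X ⊗ _]/(proj (ket b)).
  by rewrite proj_ketE tensorZl tensorDl tensorZl (tensor1 1 n).
- move=> P /pauliSP [A [B [hA hB ->]]].
  have [[f hf]|[f hf]] := pauli1_ket hA.
    left; exists (f b), B; split=> //.
    by rewrite -{2}[B]tensor1l !tensor_mul mulmx1 mul1mx hf tensorZl mulmx1.
  right; rewrite adjmx_tensor adjmx1 !tensor_mul -mulmxA hf -scalemxAr ket_bra.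
  have -> : (b == ~~ b) = false by case: b.
  by rewrite mulr0n raddf0 scaler0 tensor0l.
move=> P' hP'; exists ((1%:M : qmat R 1 1) ⊗ (P' : qmat R n n)); split.
- by apply: pauli_cons => //; constructor.
- by rewrite -{2}[P']tensor1l !tensor_mul !mulmx1 !mul1mx.
by rewrite -{2}[P']tensor1l adjmx_tensor adjmx1 !tensor_mul !mulmx1 !mul1mx.
Qed.

Lemma insertion_next m n Z b (V : qmat R m n) : insertion Z b V ->
  @insertion (1 + m) (1 + n) ((1%:M : qmat R 1 1) ⊗ Z) b ((1%:M : qmat R 1 1) ⊗ V).
Proof.
move=> [VV eZ h3 h4]; split.
- by rewrite adjmx_tensor adjmx1 tensor_mul VV mulmx1 (tensor1 1 n).
- by rewrite adjmx_tensor adjmx1 tensor_mul eZ mulmx1 tensorZr tensorDr tensorZr (tensor1 1 m).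
- move=> P /pauliSP [A [B [hA hB ->]]].
  have [[c [P' [hP' e]]]|e] := h3 _ hB.
    left; exists c, (A ⊗ P'); split; first by apply: pauli_cons.
    by rewrite !tensor_mul mulmx1 mul1mx e tensorZr.
  by right; rewrite adjmx_tensor adjmx1 !tensor_mul e tensor0r.
move=> P /pauliSP [A [B [hA hB ->]]].
have [P' [hP' e1 e2]] := h4 _ hB.
exists (A ⊗ P'); split; first by apply: pauli_cons.
  by rewrite !tensor_mul mulmx1 mul1mx e1.
by rewrite adjmx_tensor adjmx1 !tensor_mul mulmx1 mul1mx e2.
Qed.

(** Follows the recursion of [insert_ket], so that one induction treats both. *)
Fixpoint pauliZ_at (n i : nat) : qmat R n.+1 n.+1 :=
  match n, i with
  | n'.+1, i'.+1 => (1%:M : qmat R 1 1) ⊗ pauliZ_at n' i'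
  | n', _ => xz false true ⊗ (1%:M : qmat R n' n')
  end.

Lemma insertion_insert_ket n i b : insertion (pauliZ_at n i) b (insert_ket b n i).
Proof.
elim: n i => [|n ih] [|i]; try exact: insertion_here.
exact: (insertion_next (ih i)).
Qed.

Lemma pauli_pauliZ_at n i : pauli (pauliZ_at n i).
Proof.
have hZ := @pauli1_xz R false true.
elim: n i => [|n ih] [|i]; try by apply: pauli_cons => //; apply: pauli_one.
by apply: pauli_cons => //; constructor.
Qed.

Lemma pauliZ_at_sqr n i : pauliZ_at n i *m pauliZ_at n i = 1%:M.
Proof.
have ZZ := @xz_sqr R false true isT.
have base k : (xz false true ⊗ (1%:M : qmat R k k) : qmat R k.+1 k.+1) *m
    (xz false true ⊗ (1%:M : qmat R k k)) = 1%:M.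
  by rewrite mul_tensorS ZZ mulmx1 tensorS1.
have step k (Z : qmat R k k) : Z *m Z = 1%:M ->
    ((1%:M : qmat R 1 1) ⊗ Z : qmat R k.+1 k.+1) *m ((1%:M : qmat R 1 1) ⊗ Z) = 1%:M.
  by move=> e; rewrite mul_tensorS mulmx1 e tensorS1.
elim: n i => [|n ih] [|i]; try exact: base.
exact: step (ih i).
Qed.

Lemma insert_ket_adjK b n i : (insert_ket b n i : qmat R n.+1 n) ^t* *m insert_ket b n i = 1%:M.
Proof. by have [] := insertion_insert_ket n i b. Qed.

Lemma meas_projE b n (i : 'I_n.+1) :
  meas_proj b i = 2^-1 *: (1%:M + (-1) ^+ b *: pauliZ_at n i).
Proof. by have [] := insertion_insert_ket n i b. Qed.

Lemma meas_proj_sum n (i : 'I_n.+1) : \sum_b (meas_proj b i : qmat R n.+1 n.+1) = 1%:M.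
Proof.
rewrite big_bool /= [X in X + _]meas_projE [X in _ + X]meas_projE -scalerDr.
apply: etrans (scale_half_double _); congr (_ *: _).
by rewrite expr0 expr1 scale1r scaleN1r addrACA addNr addr0.
Qed.

Lemma meas_proj_adj b n (i : 'I_n.+1) :
  (meas_proj b i : qmat R n.+1 n.+1) ^t* = meas_proj b i.
Proof. by rewrite /meas_proj adjmxM adjmxK. Qed.

Lemma meas_proj_idem b n (i : 'I_n.+1) :
  meas_proj b i *m meas_proj b i = meas_proj b i :> qmat R n.+1 n.+1.
Proof.
rewrite /meas_proj; have := insert_ket_adjK b n i.
by move: (insert_ket b n i) => V VV; rewrite mulmxA -[V *m _ *m V]mulmxA VV mulmx1.
Qed.

(** One operator per branch. A discarded qubit gives two, as if it were measured and the outcome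
    forgotten. *)
Fixpoint kraus m n (p : @protocol R m n) : seq (qmat R m n) :=
  match p in protocol _ n return seq (qmat R m n) with
  | Stop => [:: 1%:M]
  | @Append _ _ n i b p' => [seq L *m insert_ket b n i | L <- kraus p']
  | Apply _ U _ p' => [seq L *m U | L <- kraus p']
  | Measure _ i p' =>
      [seq L *m meas_proj true i | L <- kraus (p' true)] ++
      [seq L *m meas_proj false i | L <- kraus (p' false)]
  | @Discard _ _ n i p' =>
      [seq L *m (insert_ket true n i) ^t* | L <- kraus p'] ++
      [seq L *m (insert_ket false n i) ^t* | L <- kraus p']
  end.

Lemma run_kraus m n (p : @protocol R m n) rho :
  run p rho = \sum_(L <- kraus p) L *m rho *m L ^t*.
Proof.
elim: p rho => {n} [|n i b p ih|n U hU p ih|n i p ih|n i p ih] rho /=.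
- by rewrite big_seq1 adjmx1 mul1mx mulmx1.
- by rewrite ih big_map; apply: eq_bigr => L _; rewrite adjmxM !mulmxA.
- by rewrite ih big_map; apply: eq_bigr => L _; rewrite adjmxM !mulmxA.
- rewrite big_cat /= !big_map big_bool /= !ih; congr (_ + _);
  by apply: eq_bigr => L _; rewrite adjmxM meas_proj_adj !mulmxA.
rewrite ih big_cat /= !big_map -big_split /=; apply: eq_bigr => L _.
by rewrite big_bool !adjmxM !adjmxK mulmxDr mulmxDl !mulmxA.
Qed.

(** Applied to the rest of a protocol, this writes the Gram matrix of the operator accumulated at a
    node as a sum over the leaves below. *)
Lemma kraus_unit m n (p : @protocol R m n) :
  \sum_(L <- kraus p) L ^t* *m L = 1%:M.
Proof.
have sandwich k (s : seq (qmat R m k)) l (V : qmat R k l) :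
    \sum_(L <- [seq L *m V | L <- s]) L ^t* *m L =
    V ^t* *m (\sum_(L <- s) L ^t* *m L) *m V.
  rewrite big_map mulmx_sumr mulmx_suml; apply: eq_bigr => L _.
  by rewrite adjmxM !mulmxA.
elim: p => {n} [|n i b p ih|n U hU p ih|n i p ih|n i p ih] /=.
- by rewrite big_seq1 adjmx1 mul1mx.
- by rewrite sandwich ih mulmx1 insert_ket_adjK.
- by rewrite sandwich ih mulmx1 clifford_adjK.
- rewrite big_cat /= !sandwich !ih !mulmx1 !meas_proj_adj !meas_proj_idem.
  by rewrite -(meas_proj_sum i) big_bool.
rewrite big_cat /= !sandwich !ih !mulmx1 !adjmxK.
by rewrite -(meas_proj_sum i) big_bool.
Qed.

End Insertion.

(** * Operators through which Pauli matrices can be tracked *)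

Section Tracking.
Context {R : realType}.

(* Invariant of the Kraus operators of a protocol as long as no measurement has
   revealed anything about the input: M is a multiple of an isometry, and every
   output Pauli is pulled back to an input Pauli or else averages to zero. *)
Definition pauli_tracking n m (M : qmat R n m) :=
  (exists c, M ^t* *m M = c%:M) /\
  forall P, pauli P ->
    (exists t T, pauli T /\ P *m M = t *: (M *m T)) \/ M ^t* *m P *m M = 0.

Lemma pauli_tracking1 n : pauli_tracking (1%:M : qmat R n n).
Proof.
split; first by exists 1; rewrite adjmx1 mulmx1.
by move=> P hP; left; exists 1, P; rewrite mulmx1 mul1mx scale1r.
Qed.

Lemma pauli_trackingZ n m a (M : qmat R n m) :
  pauli_tracking M -> pauli_tracking (a *: M).
Proof.
move=> [[c ec] h]; split.
  exists (a ^* * (a * c)); rewrite adjmxZ -scalemxAl -scalemxAr ec.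
  by rewrite scalerA scale_scalar_mx mulrA.
move=> P /h [[t [T [hT e]]]|e]; [left|right].
  exists t, T; split=> //; rewrite -scalemxAr e -scalemxAl !scalerA.
  by congr (_ *: _); rewrite mulrC.
by rewrite adjmxZ -!scalemxAl -scalemxAr e !scaler0.
Qed.

Lemma gram_eq0 n m (M : qmat R n m) : M ^t* *m M = 0 -> M = 0.
Proof.
move=> h; apply/matrixP=> i j; rewrite mxE.
have /eqP : dot (M *m (delta_mx j 0 : 'cV_(2 ^ m))) (M *m delta_mx j 0) = 0.
  by rewrite dot_mul mulmxA h mul0mx /dot adjmx0 mul0mx mxtrace0.
rewrite dot_eq0 => /eqP /matrixP /(_ i 0); rewrite -colE mxE => ->.
by rewrite mxE.
Qed.

Lemma pauli_tracking0 n m : pauli_tracking (0 : qmat R n m).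
Proof.
split; first by exists 0; rewrite mulmx0 raddf0.
by move=> P hP; right; rewrite mulmx0.
Qed.

Lemma pauli_tracking_clifford n m (U : qmat R n n) (M : qmat R n m) :
  clifford U -> pauli_tracking M -> pauli_tracking (U *m M).
Proof.
move=> hU [[c ec] h]; have UU := clifford_adjK hU; have UU' := mulmx1C UU; split.
  by exists c; rewrite adjmxM mulmxA -[_ *m U ^t* *m U]mulmxA UU mulmx1.
move=> P /(clifford_conjV hU) /h [[t [T [hT e]]]|e]; [left|right].
  by exists t, T; split=> //; rewrite -mulmxA scalemxAr -e !mulmxA UU' mul1mx.
by rewrite -e adjmxM !mulmxA.
Qed.

(** * Effect of one protocol step on the invariant *)

Section Step.
Variables (m n k : nat) (Z : qmat R m m) (b : bool) (V : qmat R m n).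
Hypotheses (hV : insertion Z b V) (hZ : pauli Z) (ZZ : Z *m Z = 1%:M).

Lemma pauli_tracking_insert (M : qmat R n k) :
  pauli_tracking M -> pauli_tracking (V *m M).
Proof.
have [VV _ h3 _] := hV; move=> [[c ec] h]; split.
  by exists c; rewrite adjmxM mulmxA -[_ *m V ^t* *m V]mulmxA VV mulmx1.
have eq P : (V *m M) ^t* *m P *m (V *m M) = M ^t* *m (V ^t* *m P *m V) *m M.
  by rewrite adjmxM !mulmxA.
move=> P /h3 [[a [P' [hP' e]]]|e]; last by right; rewrite eq e mulmx0 mul0mx.
have [[t [T [hT e']]]|e'] := h _ hP'; [left|right].
  exists (a * t), T; split=> //.
  by rewrite mulmxA e -scalemxAl -mulmxA e' -scalemxAr scalerA mulmxA.
rewrite eq -[V ^t* *m P *m V]mulmxA e -scalemxAr mulmxA VV mul1mx.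
by rewrite -scalemxAr -scalemxAl e' scaler0.
Qed.

(** The projector onto outcome [b], given by an equation so that [meas_proj] can take its place. *)
Variable Pi : qmat R m m.
Hypothesis ePi : Pi = V *m V ^t*.

(** On the range of [Pi] the adjoint of [V] is undone by [V], so Paulis of the smaller register lift
    to the larger one. *)
Lemma pauli_tracking_remove (M : qmat R m k) :
  Pi *m M = M -> pauli_tracking M -> pauli_tracking (V ^t* *m M).
Proof.
move=> PiM [[c ec] h]; have [_ _ _ h4] := hV.
have VM : V *m (V ^t* *m M) = M by rewrite mulmxA -ePi.
split; first by exists c; rewrite adjmxM adjmxK -mulmxA VM.
move=> P' /h4 [P [/h hP e1 e2]]; case: hP => [[t [T [hT e]]]|e]; [left|right].
  by exists t, T; split=> //; rewrite mulmxA -e2 -mulmxA e -scalemxAr mulmxA.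
by rewrite adjmxM adjmxK -[_ *m V *m P']mulmxA -e1 -!mulmxA VM mulmxA.
Qed.

Let s : R[i] := (-1) ^+ b.

Let ss : s * s = 1.
Proof. by rewrite -signr_addb addbb. Qed.

Lemma insertion_idem : Pi *m Pi = Pi.
Proof.
have [VV _ _ _] := hV.
by rewrite ePi mulmxA -[V *m _ *m V]mulmxA VV mulmx1.
Qed.

Lemma insertion_adj : Pi ^t* = Pi.
Proof. by rewrite ePi adjmxM adjmxK. Qed.

Lemma insertionE : Pi = 2^-1 *: (1%:M + s *: Z).
Proof. by rewrite ePi; have [] := hV. Qed.

Lemma insertion_eigenl : Z *m Pi = s *: Pi.
Proof.
rewrite insertionE -scalemxAr scalerA mulrC -scalerA; congr (_ *: _).
by rewrite mulmxDr mulmx1 -scalemxAr ZZ scalerDr scalerA ss scale1r addrC.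
Qed.

Lemma insertion_eigenr : Pi *m Z = s *: Pi.
Proof.
rewrite insertionE -scalemxAl scalerA mulrC -scalerA; congr (_ *: _).
by rewrite mulmxDl mul1mx -scalemxAl ZZ scalerDr scalerA ss scale1r addrC.
Qed.

(** [Z] acts as the same sign on both sides of [Pi]; passing it through [P] shows that the
    compression of [P] is its own negative. *)
Lemma insertion_anti P : Z *m P = - (P *m Z) -> Pi *m P *m Pi = 0.
Proof.
move=> anti.
have e1 : Pi *m (P *m (Z *m Pi)) = s *: (Pi *m P *m Pi).
  by rewrite insertion_eigenl -!scalemxAr mulmxA.
have e2 : Pi *m ((Z *m P) *m Pi) = s *: (Pi *m P *m Pi).
  by rewrite !mulmxA insertion_eigenr -!scalemxAl.
have : s *: (Pi *m P *m Pi) = - (s *: (Pi *m P *m Pi)).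
  by rewrite -{1}e2 anti mulNmx mulmxN -e1 !mulmxA.
move=> /eqP; rewrite -addr_eq0 => /eqP e.
have := scale_half_double (s *: (Pi *m P *m Pi)); rewrite e scaler0 => /esym /eqP.
by rewrite scaler_eq0 signr_eq0 => /eqP.
Qed.

Lemma insertion_gram (M : qmat R m k) :
  (Pi *m M) ^t* *m (Pi *m M) =
  2^-1 *: (M ^t* *m M + s *: (M ^t* *m Z *m M)).
Proof.
rewrite adjmxM insertion_adj mulmxA -[_ *m Pi *m Pi]mulmxA insertion_idem.
rewrite insertionE -scalemxAr -scalemxAl mulmxDr mulmx1 mulmxDl.
by rewrite -scalemxAr -scalemxAl.
Qed.

(** A scalar Gram matrix means that the outcome reveals nothing. If [Z] pulls back to an input
    Pauli, projecting amounts to a scalar. Otherwise each [P] is treated according to whether it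
    commutes with [Z]. *)
Lemma pauli_tracking_measure (M : qmat R m k) g :
  (Pi *m M) ^t* *m (Pi *m M) = g%:M ->
  pauli_tracking M -> pauli_tracking (Pi *m M).
Proof.
rewrite insertion_gram => eg hM; have [[c ec] h] := hM.
have [[t [T [hT e]]]|e] := h _ hZ.
  have [c0|c0] := eqVneq c 0.
    have -> : M = 0 by apply: gram_eq0; rewrite ec c0 raddf0.
    by rewrite mulmx0; apply: pauli_tracking0.
  pose W : qmat R k k := 2^-1 *: (1%:M + s *: (t *: T)).
  have PM : Pi *m M = M *m W.
    rewrite insertionE /W -scalemxAl -scalemxAr mulmxDl mul1mx -scalemxAl e.
    by rewrite mulmxDr mulmx1 -!scalemxAr.
  (* The Gram matrix of [Pi *m M] is [c] times [W], which forces [W] to be scalar. *)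
  have cW : c *: W = g%:M.
    rewrite -eg -[_ *m Z *m M]mulmxA e -scalemxAr mulmxA ec mul_scalar_mx /W.
    have swap (x y : R[i]) (A : qmat R k k) : x *: (y *: A) = y *: (x *: A).
      by rewrite !scalerA mulrC.
    rewrite [LHS]swap scalerDr scale_scalar_mx mulr1.
    by rewrite [c *: (s *: _)]swap [c *: (t *: _)]swap.
  have -> : Pi *m M = (c^-1 * g) *: M.
    have eW : W = (c^-1 * g)%:M by rewrite -scale_scalar_mx -cW scalerA mulVf // scale1r.
    by rewrite PM eW mul_mx_scalar.
  exact: pauli_trackingZ.
split; first by exists g; rewrite insertion_gram.
have adjPi : (Pi *m M) ^t* = M ^t* *m Pi by rewrite adjmxM insertion_adj.
move=> P hP; have [[] hc] := pauli_comm hP hZ.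
  right; rewrite expr1 scaleN1r in hc.
  have -> : (Pi *m M) ^t* *m P *m (Pi *m M) = M ^t* *m (Pi *m P *m Pi) *m M.
    by rewrite adjPi !mulmxA.
  by rewrite insertion_anti // mulmx0 mul0mx.
rewrite expr0 scale1r in hc.
have cP : P *m Pi = Pi *m P.
  rewrite insertionE -scalemxAr -scalemxAl mulmxDr mulmxDl mulmx1 mul1mx.
  by rewrite -scalemxAr -scalemxAl hc.
have [[t [T [hT eT]]]|e1] := h _ hP.
  left; exists t, T; split=> //.
  by rewrite mulmxA cP -mulmxA eT -scalemxAr mulmxA.
(* On the range of [Pi], [P] and [P *m Z] agree up to sign, so tracking either suffices; if both
   average to zero, so does [P] after the projection. *)
have hPZ : pauli (P *m Z) by apply: pauliM.
have [[t [T [hT eT]]]|e2] := h _ hPZ.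
  left; exists (s * t), T; split=> //.
  have -> : P *m (Pi *m M) = s *: (Pi *m (P *m Z *m M)).
    by rewrite !mulmxA -cP -[P *m Pi *m Z]mulmxA insertion_eigenr -scalemxAr
       -scalemxAl scalerA ss scale1r.
  by rewrite eT -scalemxAr scalerA mulmxA.
right; have -> : (Pi *m M) ^t* *m P *m (Pi *m M) = M ^t* *m (P *m Pi) *m M.
  transitivity (M ^t* *m (Pi *m (P *m Pi)) *m M); first by rewrite adjPi !mulmxA.
  by rewrite cP [Pi *m (Pi *m P)]mulmxA insertion_idem.
have -> : P *m Pi = 2^-1 *: (P + s *: (P *m Z)).
  by rewrite insertionE -scalemxAr mulmxDr mulmx1 -scalemxAr.
rewrite -scalemxAr -scalemxAl mulmxDr mulmxDl e1 add0r.
by rewrite -scalemxAr -scalemxAl e2 !scaler0.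
Qed.

End Step.
End Tracking.

(** * The channel admits no stabilizer protocol *)

Section NoGo.
Context {R : realType}.

(* The action of the Pauli with [xz]-exponents [p] on labels, phases being dropped. *)
Definition shift1 (p x : bool * bool) := (x.1, x.2 (+) (if x.1 then p.2 else p.1)).
Definition shift (p x : label) : label :=
  (shift1 p.1.1 x.1.1, shift1 p.1.2 x.1.2, shift1 p.2 x.2).

Lemma xz_qubit p x : exists2 w : R[i], w != 0 &
  xz p.1 p.2 *m qubit x = w *: qubit (shift1 p x).
Proof.
case: p x => a b [[] s] /=.
  exists ((-1) ^+ (a && (s (+) b))); first by rewrite signr_eq0.
  rewrite /qubit /= /ket_plus -scalemxAr scalerA [_ * (sqrtC 2)^-1]mulrC -scalerA.
  congr (_ *: _); rewrite mulmxDr -scalemxAr !xz_ket scalerDr !scalerA -!signr_addb.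
  case: a b s => [] [] [];
    rewrite /= ?expr0 ?expr1 ?scale1r ?scaleN1r //; by rewrite addrC.
exists ((-1) ^+ (b && s)); first by rewrite signr_eq0.
by rewrite /qubit /= xz_ket addbC.
Qed.

Lemma X_ket_plus s : xz true false *m ket_plus s = (-1) ^+ s *: ket_plus s :> qmat R 1 0.
Proof.
rewrite /ket_plus -scalemxAr scalerA [_ * (sqrtC 2)^-1]mulrC -scalerA.
congr (_ *: _); rewrite mulmxDr -scalemxAr !xz_ket scalerDr !scalerA -!signr_addb.
by case: s; rewrite /= ?expr0 ?expr1 ?scale1r ?scaleN1r // addrC.
Qed.

Lemma i_neq0 : 'i%C != 0 :> R[i].
Proof. by rewrite -normr_eq0 norm_i oner_eq0. Qed.

Lemma pauli1_qubit (A : qmat R 1 1) : pauli1 A ->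
  exists p : bool * bool,
    (forall x, exists2 w : R[i], w != 0 & A *m qubit x = w *: qubit (shift1 p x)) /\
    (p = (false, false) -> exists w, A = w *: 1%:M).
Proof.
move=> /pauli1P [k [a [b ->]]]; exists (a, b); split=> [x|[-> ->]]; last first.
  by exists ('i%C ^+ k); rewrite xz00.
have [w w0 e] := xz_qubit (a, b) x; exists ('i%C ^+ k * w).
  by rewrite mulf_neq0 // expf_neq0 // i_neq0.
by rewrite -scalemxAl e scalerA.
Qed.

(** Both the label of |000> and, read as exponents, the trivial Pauli. *)
Definition label0 : label := comp false false false.

(** Here [p] has the type of a label but records the three pairs of exponents of [T]. *)
Lemma pauli3_qubits (T : qmat R 3 3) : pauli T ->
  exists p : label,
    (forall x, exists2 w : R[i], w != 0 & T *m qubits x = w *: qubits (shift p x)) /\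
    (p = label0 -> exists w, T = w%:M).
Proof.
move=> /pauli3P [A [B [C [/pauli1_qubit [p [hA A0]] /pauli1_qubit [q [hB B0]]
  /pauli1_qubit [r [hC C0]] ->]]]].
exists (p, q, r); split=> [x|[/A0 [a ->] /B0 [b ->] /C0 [c ->]]]; last first.
  exists (a * (b * c)).
  by rewrite op3_Zl op3_Zm op3_Zr op3_1 !scalerA scale_scalar_mx mulr1 mulrA.
have [a a0 eA] := hA x.1.1; have [b b0 eB] := hB x.1.2; have [c c0 eC] := hC x.2.
exists (a * (b * c)); first by rewrite !mulf_neq0.
by rewrite op3_ket eA eB eC ket3_Zl ket3_Zm ket3_Zr !scalerA mulrA.
Qed.

Definition offdiag_free (G : qmat R 3 3) :=
  forall x y, x \in basis -> y \in basis -> x != y ->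
    dot (qubits x) (G *m qubits y) = 0.

(* Nonzero input Paulis are excluded by computation: each of the 63 has a nonzero
   matrix entry between two distinct elements of the basis. *)
Lemma pauli_offdiag_free (T : qmat R 3 3) : pauli T -> offdiag_free T ->
  exists w, T = w%:M.
Proof.
move=> /pauli3_qubits [p [hT T0]] oT; apply: T0.
have : all (fun x => all (fun y => (x != y) ==> orth x (shift p y)) basis) basis.
  apply/allP=> x hx; apply/allP=> y hy; apply/implyP=> xy.
  rewrite -(dot_qubits_eq0 (R := R)); have [w w0 e] := hT y.
  by have /eqP := oT x y hx hy xy; rewrite e dotZr mulf_eq0 (negPf w0).
by case: p {hT} => [[[a b] [c d]] [f g]]; case: a b c d f g => [] [] [] [] [] [].
Qed.

Definition basis_diagonal (L : qmat R 3 3) :=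
  forall x, x \in basis -> exists a, L *m qubits x = a *: qubits x.

Lemma basis_diagonal_gram (I : eqType) (s : seq I) (F : I -> qmat R 3 3) :
  (forall i, i \in s -> basis_diagonal (F i)) ->
  offdiag_free (\sum_(i <- s) (F i) ^t* *m F i).
Proof.
move=> h x y hx hy xy; rewrite big_seq mulmx_suml /dot mulmx_sumr raddf_sum.
rewrite big1 // => i /h hi.
have [a ea] := hi x hx; have [b eb] := hi y hy.
rewrite -[LHS]/(dot _ _) -mulmxA dot_mul adjmxK ea eb dotZl dotZr dot_basis //.
by rewrite (negPf xy) !mulr0.
Qed.

Lemma offdiag_free1 a : offdiag_free a%:M.
Proof.
move=> x y hx hy xy; rewrite mul_scalar_mx dotZr dot_basis //.
by rewrite (negPf xy) mulr0.
Qed.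

(** If [Z] pulls back to [T], the Gram matrix is half of c + d T. Having no off-diagonal entries in
    the basis, it leaves only d = 0 or a scalar [T]. This supplies the hypothesis of
    [pauli_tracking_measure]. *)
Lemma pauli_tracking_gram n m (Z Pi : qmat R m m) b (V : qmat R m n) (M : qmat R m 3) :
  insertion Z b V -> pauli Z -> Z *m Z = 1%:M -> Pi = V *m V ^t* ->
  pauli_tracking M -> offdiag_free ((Pi *m M) ^t* *m (Pi *m M)) ->
  exists g, (Pi *m M) ^t* *m (Pi *m M) = g%:M.
Proof.
move=> hV hZ ZZ ePi [[c ec] h]; rewrite (insertion_gram hV ePi) ec.
have [[t [T [hT e]]]|->] := h _ hZ; last first.
  by rewrite scaler0 addr0 scale_scalar_mx; eexists.
rewrite -[_ *m Z *m M]mulmxA e -scalemxAr mulmxA ec mul_scalar_mx !scalerA.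
move: (_ * (t * c)) => d oG.
have [->|d0] := eqVneq d 0.
  by rewrite scale0r addr0 scale_scalar_mx; eexists.
have oT : offdiag_free T.
  move=> x y hx hy xy; have := oG x y hx hy xy.
  rewrite -scalemxAl dotZr mulmxDl dotDr -scalemxAl dotZr offdiag_free1 // add0r.
  by move=> /eqP; rewrite !mulf_eq0 invr_eq0 pnatr_eq0 (negPf d0) => /eqP.
have [w ->] := pauli_offdiag_free hT oT.
by rewrite scale_scalar_mx -raddfD scale_scalar_mx; eexists.
Qed.

End NoGo.

(** * From diagonal Kraus operators to a contradiction at |100> *)

Section Conclusion.
Context {R : realType}.

Lemma qubits_split s (y z : bool * bool) :
  qubits ((false, s), y, z) =
  (sqrtC 2)^-1 *: (qubits ((true, false), y, z) +
    (-1) ^+ s *: qubits ((true, true), y, z)) :> qmat R 3 0.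
Proof.
have e : qubit (false, s) = (sqrtC 2)^-1 *:
    (qubit (true, false) + (-1) ^+ s *: qubit (true, true)) :> qmat R 1 0.
  rewrite /qubit /= /ket_plus expr0 scale1r expr1 scaleN1r.
  rewrite [in RHS]scalerA [_ * (sqrtC 2)^-1]mulrC -scalerA -scalerDr scalerA sqrt2V_sqr.
  case: s; rewrite ?expr1 ?scaleN1r ?expr0 ?scale1r.
    by rewrite opprD opprK addrACA addrN add0r scale_half_double.
  by rewrite addrACA addrN addr0 scale_half_double.
apply: etrans (f_equal (fun u => ket3 u (qubit y) (qubit z)) e) _.
apply: etrans (ket3_Zl _ _ _ _) _; apply: (f_equal ( *:%R _)).
apply: etrans (ket3_Dl _ _ _ _) _; apply: (f_equal ( +%R _)).
exact: ket3_Zl.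
Qed.

(** Multiplying by the adjoint of [M] cancels [M] up to the nonzero [c], so eigenvalues of [P] pass
    to [S]. *)
Lemma intertwine_eigen n (M P S : qmat R n n) (u : qmat R n 0) (a s c : R[i]) :
  c != 0 -> M ^t* *m M = c%:M -> P *m M = M *m S ->
  M *m u = a *: u -> P *m u = s *: u -> S *m u = s *: u.
Proof.
move=> c0 ec PM Mu Pu; apply: (scalerI c0).
have -> : c *: (S *m u) = M ^t* *m (P *m (M *m u)).
  by rewrite -mul_scalar_mx -ec [P *m _]mulmxA PM !mulmxA.
rewrite scalerA mulrC -scalerA.
have -> : c *: u = M ^t* *m (M *m u) by rewrite -mul_scalar_mx -ec mulmxA.
by rewrite Mu -!scalemxAr Pu -scalemxAr !scalerA mulrC.
Qed.

(** The expectations at [u] of the two products in the hypotheses are both |a|^2. A Pauli fixing an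
    eigenvector of a nonzero [M] therefore cannot average to zero. *)
Lemma gram_eigen_eq0 n (M P : qmat R n n) (u : qmat R n 0) (a c : R[i]) :
  M ^t* *m M = c%:M -> M ^t* *m P *m M = 0 ->
  M *m u = a *: u -> P *m u = u -> dot u u = 1 -> c = 0.
Proof.
move=> ec e Mu Pu uu.
have dM (A : qmat R n n) : dot u (M ^t* *m A *m M *m u) = dot (M *m u) (A *m (M *m u)).
  by rewrite -!mulmxA [LHS]dot_mul adjmxK.
have := dM P; rewrite e mul0mx dot0r Mu -scalemxAr Pu.
have := dM 1%:M; rewrite mul1mx mulmx1 ec mul_scalar_mx Mu dotZr uu mulr1.
by move=> -> <-.
Qed.

(** Up to the common factor, |0> and |1> are the sum and the difference of |+> and |->. *)
Lemma split_eigen (S : qmat R 3 3) y z :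
  S *m qubits ((true, false), y, z) = 1 *: qubits ((true, false), y, z) ->
  S *m qubits ((true, true), y, z) = (-1) *: qubits ((true, true), y, z) ->
  S *m qubits ((false, false), y, z) = qubits ((false, true), y, z).
Proof.
move=> S1 S4; rewrite [X in _ *m X]qubits_split [RHS]qubits_split.
move: (qubits _) (qubits _) S1 S4 => u v S1 S4.
by rewrite -scalemxAr mulmxDr -scalemxAr S1 S4 expr0 expr1 !scale1r.
Qed.

(** Proportional unit vectors overlap; the boolean form allows case analysis on labels. *)
Lemma dot_qubits_scale_orth (w : R[i]) x y :
  qubits x = w *: qubits y -> orth x y = false.
Proof.
move=> e; rewrite -(dot_qubits_eq0 (R := R)); apply/negP => /eqP o.
have := dot_qubits_id (R := R) x; rewrite {2}e dotZr o mulr0 => /eqP.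
by rewrite eq_sym oner_eq0.
Qed.

(** Evaluating P M [v0] in two ways makes M [v1] proportional to [v1]. *)
Lemma leak_eq0 n (M P S T : qmat R n n) (v0 v1 v : qmat R n 0) (b t w : R[i]) :
  P *m M = M *m S -> S = t *: T -> M *m v0 = b *: v0 -> P *m v0 = v1 ->
  T *m v0 = w *: v1 -> w != 0 -> t != 0 -> dot v v1 = 0 -> dot v (M *m v1) = 0.
Proof.
move=> PM eS Mv0 Pv0 Tv0 w0 t0 o.
have e : (t * w) *: (M *m v1) = b *: v1.
  transitivity (P *m (M *m v0)); last by rewrite Mv0 -scalemxAr Pv0.
  by rewrite mulmxA PM -mulmxA eS -scalemxAl Tv0 scalerA -scalemxAr.
have /eqP := congr1 (dot v) e; rewrite !dotZr o mulr0 !mulf_eq0.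
by rewrite (negPf t0) (negPf w0) => /eqP.
Qed.

(* X on the first qubit is pulled back to a Pauli fixing |+10> and negating |-10>,
   hence one with X-part 100; it maps |000> to |100> up to phase, so M |100> is
   proportional to |100>. *)
Lemma tracking_leaf (M : qmat R 3 3) :
  pauli_tracking M -> basis_diagonal M ->
  dot (qubits (comp true false true)) (M *m qubits (comp true false false)) = 0.
Proof.
move=> [[c ec] h] dM; have [c0|c0] := eqVneq c 0.
  have -> : M = 0 by apply: gram_eq0; rewrite ec c0 raddf0.
  by rewrite mul0mx dot0r.
pose x1 : label := ((true, false), (false, true), (false, false)).
pose x4 : label := ((true, true), (false, true), (false, false)).
have [a1 e1] := dM x1 isT; have [a4 e4] := dM x4 isT.
have [b eb] := dM label0 isT.
have [P [hP P1 P4 P0]] : exists P : qmat R 3 3, [/\ pauli P,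
    P *m qubits x1 = qubits x1, P *m qubits x4 = (-1) *: qubits x4 &
    P *m qubits label0 = qubits (comp true false false)].
  exists (op3 (xz true false) 1%:M 1%:M); split.
  - by apply: pauli_op3; [apply: pauli1_xz|constructor|constructor].
  - by apply: etrans (op3_ket _ _ _ _ _ _) _; rewrite !mul1mx X_ket_plus scale1r.
  - apply: etrans (op3_ket _ _ _ _ _ _) _; rewrite !mul1mx X_ket_plus.
    exact: ket3_Zl.
  by apply: etrans (op3_ket _ _ _ _ _ _) _; rewrite !mul1mx xz_ket scale1r.
(* Averaging to zero is excluded by |+10>, an eigenvector of [M] fixed by [P]. *)
have [[t [T [hT eT]]]|e] := h _ hP; last first.
  by have := gram_eigen_eq0 ec e e1 P1 (dot_qubits_id x1) => /eqP; rewrite (negPf c0).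
have [S eS] : exists S, S = t *: T by exists (t *: T).
have PM : P *m M = M *m S by rewrite eS -scalemxAr.
have P1' : P *m qubits x1 = 1 *: qubits x1 by rewrite scale1r.
have S010 := split_eigen (intertwine_eigen c0 ec PM e1 P1')
  (intertwine_eigen c0 ec PM e4 P4).
have [p [hp _]] := pauli3_qubits hT.
have [w w0 ew] := hp (comp false true false).
have [w' w0' ew'] := hp label0.
have e110 : qubits (comp true true false) = (t * w) *: qubits (shift p (comp false true false)).
  by rewrite -scalerA -ew scalemxAl -eS; apply: esym.
have t0 : t != 0.
  apply/eqP => t0; have := dot_qubits_id (R := R) (comp true true false).
  by rewrite {2}e110 t0 mul0r scale0r dot0r => /eqP; rewrite eq_sym oner_eq0.
have op := dot_qubits_scale_orth e110.
(* As |110> is not orthogonal to the image of |010>, only the X-exponents 100 remain. *)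
have sp : shift p label0 = comp true false false.
  by case: p op {hp ew ew' e110} => [[[a ?] [d ?]] [f ?]]; case: a d f => [] [] [].
rewrite sp in ew'.
have o : dot (qubits (comp true false true)) (qubits (comp true false false)) = 0 :> R[i].
  by apply/eqP; rewrite dot_qubits_eq0.
exact: (leak_eq0 PM eS eb P0 ew' w0' t0 o).
Qed.

Lemma isometry_gram m n k (V : qmat R m n) (W : qmat R n k) :
  V ^t* *m V = 1%:M -> (V *m W) ^t* *m (V *m W) = W ^t* *m W.
Proof. by move=> VV; rewrite adjmxM -mulmxA [V ^t* *m (V *m W)]mulmxA VV mul1mx. Qed.

(** Induction on the protocol, with [M] the operator accumulated so far. Diagonality at all leaves
    keeps each outcome uninformative, so the invariant reaches the leaf and [tracking_leaf]
    applies. *)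
Lemma no_leak n (p : @protocol R 3 n) (M : qmat R n 3) :
  pauli_tracking M ->
  (forall L, L \in kraus p -> basis_diagonal (L *m M)) ->
  forall L, L \in kraus p ->
    dot (qubits (comp true false true)) (L *m M *m qubits (comp true false false)) = 0.
Proof.
(* Completeness of the remaining branches turns this Gram matrix into a sum over leaves, each term
   diagonal in the basis. *)
have gram m (q : @protocol R 3 m) (A : qmat R m 3) :
    (forall L, L \in kraus q -> basis_diagonal (L *m A)) -> offdiag_free (A ^t* *m A).
  move=> h; have -> : A ^t* *m A = \sum_(L <- kraus q) (L *m A) ^t* *m (L *m A).
    transitivity (A ^t* *m (\sum_(L <- kraus q) L ^t* *m L) *m A).
      by rewrite kraus_unit mulmx1.
    rewrite mulmx_sumr mulmx_suml; apply: eq_bigr => L _.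
    by rewrite adjmxM !mulmxA.
  exact: basis_diagonal_gram.
elim: p M => {n} [|n i b p ih|n U hU p ih|n i p ih|n i p ih] M tM hM L /=.
- move=> hL; apply: tracking_leaf; last exact: hM.
  by move: hL; rewrite inE => /eqP ->; rewrite mul1mx.
- move=> /mapP [L' hL' ->]; rewrite -[L' *m _ *m M]mulmxA; apply: ih hL'.
    exact: (pauli_tracking_insert (insertion_insert_ket n i b)).
  by move=> L'' hL''; rewrite mulmxA; apply: hM; apply: map_f.
- move=> /mapP [L' hL' ->]; rewrite -[L' *m _ *m M]mulmxA; apply: ih hL'.
    exact: pauli_tracking_clifford.
  by move=> L'' hL''; rewrite mulmxA; apply: hM; apply: map_f.
- have step b : forall L', L' \in kraus (p b) ->
      dot (qubits (comp true false true))
        (L' *m meas_proj b i *m M *m qubits (comp true false false)) = 0.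
    move=> L' hL'; rewrite -[L' *m _ *m M]mulmxA.
    have hb L'' : L'' \in kraus (p b) -> basis_diagonal (L'' *m (meas_proj b i *m M)).
      move=> hL''; rewrite mulmxA; apply: hM; rewrite /= mem_cat.
      by apply/orP; case: b hL'' {hL'} => hL''; [left|right]; apply: map_f.
    apply: ih hL' => //.
    have hV := insertion_insert_ket (R := R) n i b.
    have [g eg] := pauli_tracking_gram hV (pauli_pauliZ_at n i) (pauliZ_at_sqr n i)
      (erefl (meas_proj b i)) tM (gram _ _ _ hb).
    exact: (pauli_tracking_measure hV (pauli_pauliZ_at n i) (pauliZ_at_sqr n i)
      (erefl _) eg tM).
  by rewrite mem_cat => /orP [] /mapP [L' hL' ->]; apply: step.
(* Discarding is split into projecting the qubit onto |b> and then removing it. *)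
have step b : forall L', L' \in kraus p ->
    dot (qubits (comp true false true))
      (L' *m (insert_ket b n i) ^t* *m M *m qubits (comp true false false)) = 0.
  move=> L' hL'; rewrite -[L' *m _ *m M]mulmxA.
  have hb L'' : L'' \in kraus p -> basis_diagonal (L'' *m ((insert_ket b n i) ^t* *m M)).
    move=> hL''; rewrite mulmxA; apply: hM; rewrite /= mem_cat.
    by apply/orP; case: b {hL'}; [left|right]; apply: map_f.
  apply: ih hL' => //.
  have hV := insertion_insert_ket (R := R) n i b.
  move: (insert_ket b n i) hV hb => V hV hb.
  have VV : V ^t* *m V = 1%:M by case: hV.
  pose Pi := V *m V ^t*.
  (* Since [V] is an isometry, projecting gives the same Gram matrix as removing the qubit. *)
  have og : offdiag_free ((Pi *m M) ^t* *m (Pi *m M)).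
    have -> : (Pi *m M) ^t* *m (Pi *m M) = (V ^t* *m M) ^t* *m (V ^t* *m M).
      by rewrite /Pi -mulmxA; apply: isometry_gram.
    exact: gram hb.
  have [g eg] := pauli_tracking_gram hV (pauli_pauliZ_at n i) (pauliZ_at_sqr n i)
    (erefl Pi) tM og.
  have tPM := pauli_tracking_measure hV (pauli_pauliZ_at n i) (pauliZ_at_sqr n i)
    (erefl Pi) eg tM.
  have -> : V ^t* *m M = V ^t* *m (Pi *m M).
    by rewrite /Pi !mulmxA VV mul1mx.
  apply: (pauli_tracking_remove hV (erefl Pi)) tPM.
  by rewrite mulmxA (insertion_idem hV (erefl Pi)).
by rewrite mem_cat => /orP [] /mapP [L' hL' ->]; apply: step.
Qed.

Lemma dot_proj n (u v : qmat R n 0) : dot u (proj v *m u) = `|dot v u| ^+ 2.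
Proof. by rewrite proj_mulket dotZr normCK -dotC mulrC. Qed.

(** The part [w] of [v] orthogonal to [e] has expectation 0 in the sum. By positivity every term
    vanishes there, so [v] is orthogonal to [w] and [w] is 0. *)
Lemma sum_proj_line n (s : seq (qmat R n 0)) (e : qmat R n 0) k :
  dot e e = 1 -> \sum_(v <- s) proj v = k *: proj e ->
  forall v, v \in s -> v = dot e v *: e.
Proof.
move=> ee hs v hv; pose w := v - dot e v *: e.
have ew : dot e w = 0 by rewrite /w -scaleN1r dotDr !dotZr ee mulr1 mulN1r subrr.
have : dot w ((\sum_(v <- s) proj v) *m w) = 0.
  by rewrite hs -scalemxAl dotZr dot_proj ew normr0 expr0n mulr0.
rewrite mulmx_suml /dot mulmx_sumr raddf_sum => /eqP.
rewrite psumr_eq0 => [/allP /(_ v hv) /=|u _]; last first.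
  by rewrite -[X in 0 <= X]/(dot w (proj u *m w)) dot_proj exprn_ge0.
rewrite -[X in X == 0]/(dot w (proj v *m w)) dot_proj expf_eq0 normr_eq0 /= => /eqP vw.
have : dot w w = 0.
  by rewrite {1}/w -scaleN1r scalerA dotDl dotZl vw ew mulr0 addr0.
by move=> /eqP; rewrite dot_eq0 subr_eq0 => /eqP.
Qed.

Lemma psi_kraus_diagonal i : basis_diagonal (psi_kraus i : qmat R 3 3).
Proof.
move=> x hx; rewrite /psi_kraus; case: unliftP => [mu _|_]; last first.
  rewrite cat_proj_ket //; case: ifP => _; last by exists 1; rewrite scale1r.
  by exists 0; rewrite scale0r.
rewrite proj_mulket psiE.
have [<-|h] := eqVneq (nth (comp false false false) psi_label mu) x.
  by eexists.
exists 0; rewrite dot_basis ?psi_label_basis // (negPf h).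
by rewrite !scale0r.
Qed.

Lemma psi_channel_not_stabilizer_operation : ~ stabilizer_operation (@psi_channel R).
Proof.
move=> [_ [p hp]].
have chan u : \sum_(L <- kraus p) proj (L *m u) = \sum_i proj (psi_kraus i *m u).
  have := hp (proj u); rewrite psi_channel_kraus run_kraus => e.
  rewrite -(eq_bigr _ (fun L _ => proj_mul L u)) -e.
  by apply: eq_bigr => i _; rewrite proj_mul.
(* The channel maps the projector onto a basis vector to a multiple of itself, so each Kraus
   operator of the protocol preserves that line. *)
have diag L : L \in kraus p -> basis_diagonal L.
  move=> hL x hx; exists (dot (qubits x) (L *m qubits x)).
  have /boolp.choice [a ha] i := @psi_kraus_diagonal i x hx.
  apply: (@sum_proj_line 3 [seq L *m qubits x | L <- kraus p] _ (\sum_i `|a i| ^+ 2)).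
  - exact: dot_qubits_id.
  - rewrite big_map chan scaler_suml; apply: eq_bigr => i _.
    by rewrite ha projZ.
  exact: map_f.
have leak L : L \in kraus p ->
    dot (qubits (comp true false true)) (L *m qubits (comp true false false)) = 0.
  move=> hL; rewrite -[L]mulmx1; apply: no_leak hL; first exact: pauli_tracking1.
  by move=> L' hL'; rewrite mulmx1; apply: diag.
pose u : qmat R 3 0 := qubits (comp true false true).
(* The weight of |101> in the output on |100>: zero by the protocol, a sum of nonnegative terms by
   the channel. *)
have := congr1 (fun A => dot u (A *m u)) (chan (qubits (comp true false false))).
rewrite !mulmx_suml /dot !mulmx_sumr !raddf_sum big_seq big1 => [/esym /eqP|L hL]; last first.
  by rewrite -[LHS]/(dot u (proj _ *m u)) dot_proj dotC leak // conjC0 normr0 expr0n.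
rewrite psumr_eq0 => [/allP h|i _]; last first.
  by rewrite -[X in 0 <= X]/(dot u (proj _ *m u)) dot_proj exprn_ge0.
(* The term of |10+>, which overlaps both |100> and |101>. *)
have := h (lift ord0 (inord 2)) (mem_index_enum _).
rewrite -[X in X == 0]/(dot u (proj _ *m u)) dot_proj expf_eq0 normr_eq0 /=.
rewrite /psi_kraus liftK proj_mulket dotZl psiE inordK // mulf_eq0 conjC_eq0.
by rewrite !dot_qubits_eq0.
Qed.

End Conclusion.

Theorem corollary1 (R : realType) :
  CSPO (@psi_channel R) /\ ~ stabilizer_operation (@psi_channel R).
Proof.
split; first exact: psi_channel_CSPO.
exact: psi_channel_not_stabilizer_operation.
Qed.
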